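(* Let $\sigma_0^2:=P_0\phi_0^2$, let $R_n:=T(\eta_n,\mathbb{P}_n)-T(\eta_0,P_0)-(\mathbb{P}_n-P_0)\phi_n$, $R_n^*:=T(\eta_n^*,\mathbb{P}_n^* )-T(\eta_n,\hat{P}_n)-(\mathbb{P}_n^*-\hat{P}_n)\phi_n^*$ and $T_n^*:=n^{1/2}[T(\eta_n^*,\mathbb{P}_n^* )-T(\eta_n,\hat{P}_n)]$. Suppose that: (A1) there exists a class $\mathcal{F}$ of measurable functions from $(\mathcal{X},\mathcal{B})$ to $\mathbb{R}$ such that $\phi_0\in\mathcal{F}$, $P_0^*(\phi_n\in\mathcal{F})\to1$, and $\mathbb{G}_n$ converges weakly to the $P_0$-Brownian bridge $\mathbb{G}_0$ in $\ell^\infty(\mathcal{F})$; (A2) $\|\phi_n-\phi_0\|_{L_2(P_0)}=o_{P_0^*}(1)$; (A3) $R_n=o_{P_0^*}(n^{-1/2})$; (B1) there exists a class $\mathcal{F}$ of measurable functions from $(\mathcal{X},\mathcal{B})$ to $\mathbb{R}$ such that $\phi_0\in\mathcal{F}$, $P_W^*(\phi_n^*\in\mathcal{F})\to1$ in $P_0^*$-outer probability, and $\mathbb{G}_n^*$ converges weakly to the $P_0$-Brownian bridge $\mathbb{G}_0$ in $\ell^\infty(\mathcal{F})$ conditionally on the data in outer probability; (B2) $\|\phi_n^*-\phi_0\|_{L_2(P_0)}=o_{P_W^*}(1)$; (B3) $R_n^*=o_{P_W^*}(n^{-1/2})$; and that $T_n^*$ is asymptotically uniformly square-integrable in the sense that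 $$\lim_{m\to\infty}\limsup_{n\to\infty}E_0^*E_W^*\left[T_n^{*2}1\{T_n^{*2}\ge m\}\right]=0.$$ Then $\bar\sigma_n\to\sigma_0$ in $P_0^*$-outer probability, where $\bar\sigma_n^2:=E_W^*[T_n^{*2}]$, so that the bootstrap Wald confidence interval $$\left[T(\eta_n,\mathbb{P}_n)+z_\beta\bar\sigma_n n^{-1/2},\;T(\eta_n,\mathbb{P}_n)+z_{1-\alpha}\bar\sigma_n n^{-1/2}\right]$$ has asymptotic confidence level $1-\alpha-\beta$.
   Context: Data and estimator. $X_1,\dots,X_n \in \mathcal{X}\subseteq\mathbb{R}^d$ are IID from a probability measure $P_0$ on $(\mathcal{X},\mathcal{B})$ lying in a statistical model $\mathcal{M}$; $\mathbb{P}_n$ is the empirical distribution; $Pf := \int f\,dP$; $\mathbb{G}_n:=n^{1/2}(\mathbb{P}_n-P_0)$. $\psi:\mathcal{M}\to\mathbb{R}$ is the target parameter, $\psi_0=\psi(P_0)$, and $\phi_0:\mathcal{X}\to\mathbb{R}$ is an influence function, with $P_0\phi_0=0$ and $P_0\phi_0^2<\infty$. $\eta:\mathcal{M}\to\mathcal{H}$ is a nuisance parameter, $\eta_0=\eta(P_0)$, and $\eta_n\in\mathcal{H}$ is an estimator of $\eta_0$ based on the data. $T:\mathcal{H}\times\mathcal{M}^+\to\mathbb{R}$, where $\mathcal{M}^+$ is the union of $\mathcal{M}$ and the finite discrete probability measures, is such that $\psi_0=T(\eta_0,P_0)$, and the estimator is $\psi_n=T(\eta_n,\mathbb{P}_n)$.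 $\phi_n:\mathcal{X}\to\mathbb{R}$ is an estimator of $\phi_0$ based on the data. Bootstrap. $W_{n1},\dots,W_{nn}$ are IID with law $Q_n$ on $(\mathcal{W}_n,\mathcal{C}_n)$, independent of the data, and $X_i^*=\gamma_n(X_1,\dots,X_n,W_{ni})$ for a fixed measurable $\gamma_n$. $\hat{P}_n$ is the conditional law of $X_i^*$ given the data, so $X_1^*,\dots,X_n^*$ are conditionally IID from $\hat{P}_n$. $\mathbb{P}_n^*$ is the empirical distribution of $X_1^*,\dots,X_n^*$ and $\mathbb{G}_n^* := n^{1/2}(\mathbb{P}_n^*-\hat{P}_n)$. $\eta_n^*\in\mathcal{H}$ is any nuisance estimator based on bootstrap and original data; $T(\eta_n,\hat P_n)$ is assumed well-defined; $\phi_n^*:\mathcal{X}\to\mathbb{R}$ is an estimator of $\phi_0$ that may depend on bootstrap and original data. $\alpha,\beta\in(0,1)$ with $\alpha+\beta<1$; $z_p$ is the lower $p$-quantile of the standard normal distribution. An interval has asymptotic confidence level $1-\alpha-\beta$ if the $P_0^*$-probability that it contains $\psi_0$ converges to $1-\alpha-\beta$. Modes of convergence. $P_0^*,E_0^*$ are outer probability and expectation; $Y_n=o_{P_0^*}(r_n)$ means $Y_n/r_n\to0$ in $P_0^*$-outer probability. The conditional outer expectation $E_W^*h$ of a map $h$ of $(X_1,\dots,X_n,W_{n1},\dots,W_{nn})$ is the infimum of $\int U(X_1,\dots,X_n,w)\,dQ_n^n(w)$ over $U\ge h$ measurable in $w$ with existing integral; $P_W^*(A)=E_W^*1_A$. $Y_n=o_{P_W^*}(r_n)$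 means that for every $\varepsilon>0$, $P_W^*(|Y_n|/r_n\ge\varepsilon)\to0$ in $P_0^*$-outer probability. $BL_1(\mathbb{D})$ is the set of 1-Lipschitz $h:\mathbb{D}\to[-1,1]$; $G_n$ converges weakly to a tight Borel measurable $G$ in $\mathbb{D}$ conditionally on the data in outer probability if $\sup_{h\in BL_1(\mathbb{D})}|E_W^*h(G_n)-E_0h(G)|\to0$ in $P_0^*$-outer probability. Unconditional weak convergence is in the Hoffmann–Jørgensen (outer expectation) sense. $\ell^\infty(\mathcal{F})$ is the space of bounded real functions on $\mathcal{F}$ with the supremum norm. The $P_0$-Brownian bridge $\mathbb{G}_0$ is the tight mean-zero Gaussian process with covariance $P_0(fg)-P_0f\,P_0g$.
   Formalization: In (A1) and (B1), ''φ_n (φ_n* ) lies in F with probability tending to 1'' is taken as: the outer probability of the complement tends to 0; the coverage claim is made only for σ_0>0 (both claims fail as literally stated otherwise). *)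

(* Defs.v *)
From HB Require Import structures.
From mathcomp Require Import all_boot all_order all_algebra.
From mathcomp Require Import all_classical all_reals all_analysis.
From mathcomp Require Import measurable_realfun.

Set Implicit Arguments.
Unset Strict Implicit.
Unset Printing Implicit Defensive.

Import Order.TTheory GRing.Theory Num.Theory.
Import numFieldNormedType.Exports.

Local Open Scope classical_set_scope.
Local Open Scope ring_scope.

Section linf.
Context (R : realType) (T : Type).

Definition linf_pred : {pred T -> R} := mem [set f : T -> R | bounded_fun f].

Record linf := Linf {
  linf_fun :> T -> R ;
  linf_bounded : linf_fun \in linf_pred }.

HB.instance Definition _ := [isSub for linf_fun].
HB.instance Definition _ := [Choice of linf by <:].

Lemma linf_boundP (f : T -> R) :
  reflect (exists M, forall t, `|f t| <= M) (f \in linf_pred).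
Proof.
apply: (iffP (asboolP _)) => [/pinfty_ex_gt0[M _ fM]|[M fM]].
  by exists M => t; exact: fM.
exists M; split; first exact: num_real.
by move=> x Mx t _; exact: le_trans (fM t) (ltW Mx).
Qed.

Lemma linf_submod_closed : submod_closed linf_pred.
Proof.
split=> [|a f g /linf_boundP[M fM] /linf_boundP[N gN]]; apply/linf_boundP.
  by exists 0 => t; rewrite normr0.
exists (`|a| * M + N) => t; rewrite (le_trans (ler_normD _ _))// lerD//.
by rewrite normrM ler_wpM2l.
Qed.

HB.instance Definition _ :=
  GRing.isSubmodClosed.Build R (T -> R) linf_pred linf_submod_closed.
HB.instance Definition _ := [SubChoice_isSubLmodule of linf by <:].

Definition supnorm (z : linf) : R := sup (range (fun t => `|z t|)).

Lemma supnorm_ub (z : linf) t : `|z t| <= supnorm z.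
Proof.
have /linf_boundP[M zM] := linf_bounded z.
by apply: ub_le_sup; [exists M => _ [s _ <-]|exists t].
Qed.

Lemma supnorm_le (z : linf) (c : R) :
  0 <= c -> (forall t, `|z t| <= c) -> supnorm z <= c.
Proof.
move=> c0 zc; rewrite /supnorm.
have [->|/set0P ne] := eqVneq (range (fun t => `|z t|)) set0.
  by rewrite sup0.
by apply: ge_sup => // _ [t _ <-].
Qed.

Lemma supnorm_ge0 (z : linf) : 0 <= supnorm z.
Proof.
have [e|/set0P[_ [t _ _]]] := eqVneq (range (fun t => `|z t|)) set0.
  by rewrite /supnorm e sup0.
exact: le_trans (normr_ge0 _) (supnorm_ub z t).
Qed.

Lemma supnormD (z y : linf) : supnorm (z + y) <= supnorm z + supnorm y.
Proof.
apply: supnorm_le => [|t]; first by rewrite addr_ge0 ?supnorm_ge0.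
by rewrite (le_trans (ler_normD _ _))// lerD// supnorm_ub.
Qed.

Lemma supnormZ (l : R) (z : linf) : supnorm (l *: z) = `|l| * supnorm z.
Proof.
apply/eqP; rewrite eq_le; apply/andP; split.
  apply: supnorm_le => [|t]; first by rewrite mulr_ge0 ?supnorm_ge0.
  by rewrite normrM ler_wpM2l// supnorm_ub.
have [->|l0] := eqVneq l 0; first by rewrite normr0 mul0r supnorm_ge0.
rewrite mulrC -ler_pdivlMr ?normr_gt0//.
apply: supnorm_le => [|t]; first by rewrite divr_ge0 ?supnorm_ge0.
rewrite ler_pdivlMr ?normr_gt0// mulrC -normrM.
exact: (supnorm_ub (l *: z) t).
Qed.

Lemma supnorm0_eq0 (z : linf) : supnorm z = 0 -> z = 0.
Proof.
move=> z0; apply/val_inj/funext => t; apply/eqP; rewrite -normr_le0 -z0.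
exact: supnorm_ub.
Qed.

HB.instance Definition _ :=
  Lmodule_isNormed.Build R linf supnormD supnormZ supnorm0_eq0.

End linf.


Definition borel_linf (R : realType) (T : Type) :=
  g_sigma_algebraType (@open (linf R T)).

Section iid.
Context d (T : measurableType d) (R : realType).

Definition tuple_cons n (t : T * n.-tuple T) : n.+1.-tuple T :=
  [the n.+1.-tuple T of t.1 :: t.2].

Lemma measurable_tuple_cons n : measurable_fun setT (@tuple_cons n).
Proof. exact: measurable_cons. Qed.

HB.instance Definition _ n :=
  isMeasurableFun.Build _ _ _ _ (@tuple_cons n) (@measurable_tuple_cons n).

(* law of (x_1, ..., x_n) for x_i IID from P, i.e. the product measure P^n;
   see iid_law_box *)
Fixpoint iid_law (P : probability T R) n : probability (n.-tuple T) R :=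
  if n is m.+1 then distribution (P \x iid_law P m)%E (@tuple_cons m)
  else \d_[tuple].

Lemma iid_law_box (P : probability T R) n (A : 'I_n -> set T) :
  (forall i, measurable (A i)) ->
  iid_law P n [set t | forall i, A i (tnth t i)] = (\prod_(i < n) P (A i))%E.
Proof.
elim: n A => [|n IHn] A mA.
  by rewrite big_ord0 /= diracE mem_set// => -[].
rewrite big_ord_recl /= /pushforward.
rewrite (_ : _ @^-1` _ = A ord0 `*`
    [set t : n.-tuple T | forall i, A (lift ord0 i) (tnth t i)]); last first.
  apply/seteqP; split => -[x t] /= => [At|[A0 At] i].
    by split => [|i]; [have := At ord0|have := At (lift ord0 i)]; rewrite ?tnthS.
  by case: (unliftP ord0 i) => [j|] ->; rewrite ?tnthS//.
rewrite product_measure1E//; first by congr (_ * _)%E; exact: IHn.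
rewrite (_ : [set _ | _] = \big[setI/setT]_(i < n)
    ((@tnth n T)^~ i @^-1` A (lift ord0 i))).
  apply: bigsetI_measurable => i _; rewrite -[X in measurable X]setTI.
  exact: measurable_tnth.
apply/seteqP; split => [t At|t].
  by elim/big_ind : _ => [//|B C Bt Ct|i _]; [split|exact: At].
move=> + i; rewrite (bigD1 i)//= => -[]; exact.
Qed.

(* The normalised sum of the n Dirac masses. For n = 0 there is no empirical
   distribution and the value is an arbitrary Dirac mass; sample size 0 plays
   no role in any limit. *)
Definition empirical n (x : n.-tuple T) : probability T R :=
  mnormalize (msum (fun i => \d_(nth point x i)) n) \d_point.

End iid.
Arguments empirical {d T R n} x.

Section outer.
Local Open Scope ereal_scope.
Context d (T : measurableType d) (R : realType) (P : probability T R).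

(* mathcomp's integral is the difference of the integrals of the positive and
   negative parts and exists as soon as one of these is finite *)
Definition integral_exists (U : T -> \bar R) :=
  \int[P]_t U^\+ t < +oo \/ \int[P]_t U^\- t < +oo.

Definition outer_expectation (h : T -> \bar R) : \bar R :=
  ereal_inf [set \int[P]_t U t | U in [set U : T -> \bar R |
    [/\ measurable_fun setT U, integral_exists U & forall t, h t <= U t]]].

Definition outer_prob (A : set T) : \bar R :=
  outer_expectation (fun t => (\1_A t)%:E).

End outer.

Section outer_convergence.
Local Open Scope ereal_scope.
Context (R : realType) (d : nat -> measure_display)
  (T : forall n, measurableType (d n)) (P : forall n, probability (T n) R).

(* Y_n -> l in outer probability, for maps Y_n with values in \bar R *)
Definition cvg_outer_prob (Y : forall n, T n -> \bar R) (l : R) :=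
  forall e : R, (0 < e)%R ->
    (fun n => outer_prob (P n) [set t | e%:E <= `|Y n t - l%:E|]) @ \oo --> 0.

(* Y_n = o_{P^*}(r_n) *)
Definition little_oP (Y : forall n, T n -> \bar R) (r : nat -> R) :=
  cvg_outer_prob (fun n t => Y n t * ((r n)^-1)%:E) 0.

End outer_convergence.

Section brownian_bridge.
Context d (X : measurableType d) (R : realType) (P : probability X R).

(* the library's normal_prob 0 s is N(0, s^2) only for s != 0 *)
Definition centered_normal (s : R) (A : set R) : \bar R :=
  if s == 0 then \d_(0 : R) A else normal_prob 0 s A.

Definition covariance_under (f g : X -> R) : R :=
  \int[P]_x (f x * g x) - \int[P]_x f x * \int[P]_x g x.

Context (F : set (X -> R)).

Definition tight (L : probability (borel_linf R F) R) :=
  forall e : R, 0 < e ->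
    exists2 K : set (linf R F), compact K & ((1 - e)%:E <= L K)%E.

(* L is the law on l^oo(F) of the P-Brownian bridge: a process is Gaussian when
   all finite linear combinations of its coordinates are *)
Definition brownian_bridge (L : probability (borel_linf R F) R) :=
  [/\ tight L,
      forall f : F, P.-integrable setT (fun x => (set_val f x ^+ 2)%:E) &
      forall k (f : 'I_k -> F) (a : 'I_k -> R) (A : set R), measurable A ->
        L [set z : linf R F | A (\sum_(i < k) a i * z (f i))] =
        centered_normal (Num.sqrt (\sum_(i < k) \sum_(j < k)
          a i * a j * covariance_under (set_val (f i)) (set_val (f j)))) A].

End brownian_bridge.

Section empirical_process.
Context d (X : measurableType d) (R : realType).

(* (P - P') f *)
Definition diff_integral (P P' : probability X R) (f : X -> R) : R :=
  \int[P]_x f x - \int[P']_x f x.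

(* n^(1/2) (P - P') as a process indexed by F *)
Definition scaled_process n (P P' : probability X R) (F : set (X -> R)) :
    F -> R :=
  fun f => Num.sqrt n%:R * diff_integral P P' (set_val f).

(* T(eta, P) - T(eta', P') - (P - P') phi *)
Definition remainder (H : Type) (T : H -> probability X R -> R)
    (eta : H) (P : probability X R) (eta' : H) (P' : probability X R)
    (phi : X -> R) : R :=
  T eta P - T eta' P' - diff_integral P P' phi.

End empirical_process.

(* Hoffmann-Jorgensen weak convergence in l^oo(I); the first clause says that
   G n takes its values in l^oo(I) *)
Definition weak_cvg (R : realType) (I : Type) (d : nat -> measure_display)
    (S : forall n, measurableType (d n)) (P : forall n, probability (S n) R)
    (G : forall n, S n -> I -> R) (L : probability (borel_linf R I) R) :=
  exists Gl : forall n, S n -> linf R I,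
    (forall n s, Gl n s = G n s :> (I -> R)) /\
    forall h : linf R I -> R, continuous h -> bounded_fun h ->
      outer_expectation (P n) (fun s => (h (Gl n s))%:E) @[n --> \oo]
        --> (\int[L]_z (h z)%:E)%E.

Definition BL1 (R : realType) (D : normedModType R) : set (D -> R) :=
  [set h | (forall z, `|h z| <= 1) /\ (forall z y, `|h z - h y| <= `|z - y|)].

Section bootstrap.
Local Open Scope ereal_scope.
Context (R : realType) d (X : measurableType d) (P0 : probability X R)
  (dW : nat -> measure_display) (W : forall n, measurableType (dW n))
  (Q : forall n, probability (W n) R)
  (gamma : forall n, {mfun (n.-tuple X * W n)%type >-> X}).

Definition resample n (x : n.-tuple X) (w : W n) : X := gamma n (x, w).

Lemma measurable_resample n (x : n.-tuple X) :
  measurable_fun setT (@resample n x).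
Proof. by apply: (measurableT_comp (f := gamma n)). Qed.

HB.instance Definition _ n x :=
  isMeasurableFun.Build _ _ _ _ (@resample n x) (@measurable_resample n x).

(* conditional law of X_i^* given that the data are x *)
Definition boot_law n (x : n.-tuple X) : probability X R :=
  distribution (Q n) (@resample n x).

Definition boot_sample n (x : n.-tuple X) (w : n.-tuple (W n)) : n.-tuple X :=
  map_tuple (resample x) w.

Definition boot_empirical n (x : n.-tuple X) (w : n.-tuple (W n)) :
    probability X R :=
  empirical (boot_sample x w).

Definition EW n (h : n.-tuple (W n) -> \bar R) : \bar R :=
  outer_expectation (iid_law (Q n) n) h.

Definition PW n (A : set (n.-tuple (W n))) : \bar R :=
  EW (fun w => (\1_A w)%:E).

(* Y_n = o_{P_W^*}(r_n) *)
Definition little_oPW (Y : forall n, n.-tuple X -> n.-tuple (W n) -> \bar R)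
    (r : nat -> R) :=
  forall e : R, (0 < e)%R -> cvg_outer_prob (iid_law P0)
    (fun n x => PW [set w | e%:E <= `|Y n x w| * ((r n)^-1)%:E]) 0.

(* weak convergence in l^oo(I) conditionally on the data in outer probability *)
Definition cond_weak_cvg (I : Type)
    (G : forall n, n.-tuple X -> n.-tuple (W n) -> I -> R)
    (L : probability (borel_linf R I) R) :=
  exists Gl : forall n, n.-tuple X -> n.-tuple (W n) -> linf R I,
    (forall n x w, Gl n x w = G n x w :> (I -> R)) /\
    cvg_outer_prob (iid_law P0) (fun n x => ereal_sup
      [set `|EW (fun w => (h (Gl n x w))%:E) - \int[L]_z (h z)%:E|
      | h in @BL1 R (linf R I)]) 0.

End bootstrap.

(* lower p-quantile of the standard normal distribution *)
Definition normal_quantile (R : realType) (p : R) : R :=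
  inf [set t : R | (p%:E <= normal_prob (0 : R) 1 `]-oo, t])%E].

(* Main.v *)
Require Import Defs.
From HB Require Import structures.
From mathcomp Require Import all_boot all_order all_algebra.
From mathcomp Require Import all_classical all_reals all_analysis.
From mathcomp Require Import measurable_realfun.
From mathcomp Require Import ring lra.

Set Implicit Arguments.
Unset Strict Implicit.
Unset Printing Implicit Defensive.

Import Order.TTheory GRing.Theory Num.Theory.
Import numFieldNormedType.Exports.

Local Open Scope classical_set_scope.
Local Open Scope ring_scope.

(** Everything happens at the single function [phi0]. By the first-order
    expansion, [n^(1/2) (psi_n - psi0)] is [n^(1/2) R_n] plus the empirical
    process at the estimated function [phi_n], and once [phi_n] may be replaced
    by [phi0] in that process, its limit is the bridge at [phi0], a centred
    normal variable of variance [sigma0^2]. The same computation, carried out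
    conditionally on the data, gives the bootstrap statistic the same limit.

    Replacing [phi_n] by [phi0] rests on the equicontinuity of the bridge at
    [phi0] in [L_2(P0)]. It follows from tightness alone together with the
    variances of the increments: a compact set of large mass is covered by
    finitely many small balls; a ball of positive mass contains, for every [f]
    close enough to [phi0], some path whose increment between [f] and [phi0] is
    small, because increments of small variance are small with probability
    close to one; all other paths in the ball then have a small increment as
    well, and the finitely many balls admit a common neighbourhood of [phi0]
    ([bridge_ball_equicontinuous], [bridge_balls_equicontinuous]). A bounded Lipschitz function of the
    supremum of the increments over that neighbourhood transfers this to the
    prelimit, by monotonicity and subadditivity of outer expectations
    ([bridge_equicontinuity_test], [weak_cvg_increment] and
    [cond_weak_cvg_increment]).

    For the variance estimator, the square is truncated at level [m], which
    makes it bounded and Lipschitz. Conditional weak convergence handles the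
    truncated square, uniform square-integrability the remainder, and the
    truncated second moment of the normal limit tends to [sigma0^2] as [m]
    grows ([cond_second_moment_cvg]).

    For the interval, coverage means that [n^(1/2) (psi_n - psi0)] lies between
    two multiples of the estimated standard deviation. Replacing the latter by
    [sigma0] moves the end points by [o(1)], which changes normal
    probabilities by [o(1)] ([studentized_outer_prob_cvg]), and the normal
    probability of the limiting interval is [1 - alpha - beta]. *)

(** * Outer expectations and outer probabilities *)

Section outer_calculus.
Local Open Scope ereal_scope.
Context d (T : measurableType d) (R : realType) (P : probability T R).
Implicit Types (f g : T -> \bar R) (A B : set T).

Lemma outer_expectation_ge0 f :
  (forall t, 0 <= f t) -> 0 <= outer_expectation P f.
Proof.
move=> f0; apply: le_ereal_inf_tmp => _ [U [_ _ fU] <-].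
by apply: integral_ge0 => t _; exact: le_trans (f0 t) (fU t).
Qed.

Lemma le_outer_expectation f g :
  (forall t, f t <= g t) -> outer_expectation P f <= outer_expectation P g.
Proof.
move=> fg; apply: le_ereal_inf => _ [U [mU iU gU] <-].
by exists U => //; split => // t; exact: le_trans (fg t) (gU t).
Qed.

Lemma outer_expectation_le_integral f U : measurable_fun setT U ->
  (forall t, 0 <= f t) -> (forall t, f t <= U t) ->
  outer_expectation P f <= \int[P]_t U t.
Proof.
move=> mU f0 fU; apply: ereal_inf_lbound; exists U => //; split => //.
right; rewrite (eq_integral (cst 0)) ?integral0 ?ltry// => t _.
by apply/ge0_funenegE; [move=> x _; exact: le_trans (f0 x) (fU x)|rewrite inE].
Qed.

Lemma outer_expectation_lub f (e : \bar R) : outer_expectation P f < e ->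
  (forall t, 0 <= f t) ->
  exists U, [/\ measurable_fun setT U, forall t, 0 <= U t,
    forall t, f t <= U t & \int[P]_t U t < e].
Proof.
move=> /ereal_inf_lt[_ [U [mU _ fU] <-] Ue] f0.
by exists U; split => // t; exact: le_trans (f0 t) (fU t).
Qed.

(** Measurable majorants of [f] and [g] that are optimal up to [e / 2] add up
    to a majorant of the sum. *)
Lemma outer_expectationD f g :
  (forall t, 0 <= f t) -> (forall t, 0 <= g t) ->
  outer_expectation P (f \+ g) <= outer_expectation P f + outer_expectation P g.
Proof.
move=> f0 g0; have Ef0 := outer_expectation_ge0 f0.
have Eg0 := outer_expectation_ge0 g0.
have [->|fy] := eqVneq (outer_expectation P f) +oo.
  by rewrite addye ?leey// gt_eqF// (lt_le_trans _ Eg0)// ltNy0.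
have [->|gy] := eqVneq (outer_expectation P g) +oo.
  by rewrite addey ?leey// gt_eqF// (lt_le_trans _ Ef0)// ltNy0.
have Ff : outer_expectation P f \is a fin_num by rewrite ge0_fin_numE// ltey.
have Fg : outer_expectation P g \is a fin_num by rewrite ge0_fin_numE// ltey.
apply/lee_addgt0Pr => e e0.
have e20 : (0 < e / 2)%R by rewrite divr_gt0.
have [|U [mU U0 fU UE]] := @outer_expectation_lub f
  (outer_expectation P f + (e / 2)%:E) _ f0; first by rewrite lteDl// lte_fin.
have [|V [mV V0 gV VE]] := @outer_expectation_lub g
  (outer_expectation P g + (e / 2)%:E) _ g0; first by rewrite lteDl// lte_fin.
apply: (@le_trans _ _ (\int[P]_t (U \+ V) t)).
  apply: outer_expectation_le_integral => [|t|t].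
  - exact: emeasurable_funD.
  - exact: adde_ge0.
  - exact: leeD.
rewrite ge0_integralD// (splitr e) EFinD [leRHS]addeACA.
by rewrite leeD// ltW.
Qed.

Lemma outer_expectation_scale_le f (c : R) : (0 < c)%R -> (forall t, 0 <= f t) ->
  outer_expectation P (fun t => c%:E * f t) <= c%:E * outer_expectation P f.
Proof.
move=> c0 f0; have Ef0 := outer_expectation_ge0 f0.
have [->|fy] := eqVneq (outer_expectation P f) +oo.
  by rewrite gt0_muley ?lte_fin// leey.
have Ff : outer_expectation P f \is a fin_num by rewrite ge0_fin_numE// ltey.
apply/lee_addgt0Pr => e e0.
have [|U [mU U0 fU UE]] := @outer_expectation_lub f
    (outer_expectation P f + (e / c)%:E) _ f0.
  by rewrite lteDl// lte_fin divr_gt0.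
apply: (@le_trans _ _ (\int[P]_t (c%:E * U t))).
  apply: outer_expectation_le_integral => [|t|t].
  - exact: measurable_funeM.
  - by rewrite mule_ge0// lee_fin ltW.
  - by rewrite lee_wpmul2l// lee_fin ltW.
rewrite ge0_integralZl_EFin//; last exact: ltW.
have -> : c%:E * outer_expectation P f + e%:E =
    c%:E * (outer_expectation P f + (e / c)%:E).
  rewrite ge0_muleDr// ?lee_fin ?divr_ge0 ?(ltW c0) ?(ltW e0)// -EFinM.
  by rewrite mulrCA divff ?mulr1// gt_eqF.
by rewrite lee_wpmul2l ?lee_fin// ltW.
Qed.

(** Follows from the inequality above, applied with [c] and with [c^-1]. *)
Lemma outer_expectation_scale f (c : R) : (0 < c)%R -> (forall t, 0 <= f t) ->
  outer_expectation P (fun t => c%:E * f t) = c%:E * outer_expectation P f.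
Proof.
move=> c0 f0; apply/eqP; rewrite eq_le outer_expectation_scale_le//=.
have c1 : c%:E * c^-1%:E = 1 :> \bar R by rewrite -EFinM divff ?gt_eqF.
have cf0 t : 0 <= c%:E * f t by rewrite mule_ge0// lee_fin ltW.
have ci0 : (0 < c^-1)%R by rewrite invr_gt0.
have := outer_expectation_scale_le ci0 cf0.
under [X in outer_expectation P X]funext => t do rewrite muleA (muleC _^-1%:E) c1 mul1e.
move=> /(lee_wpmul2l (y := _) _); move=> /(_ c%:E); rewrite lee_fin ltW// => /(_ isT).
by rewrite muleA c1 mul1e.
Qed.

Lemma outer_expectation_cst (c : R) : (0 <= c)%R ->
  outer_expectation P (cst c%:E) = c%:E.
Proof.
move=> c0; apply/eqP; rewrite eq_le; apply/andP; split.
  apply: (le_trans (outer_expectation_le_integral (U := cst c%:E) _ _ _)) => //.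
  by rewrite integral_cst//= probability_setT mule1.
apply: le_ereal_inf_tmp => _ [U [mU _ fU] <-].
rewrite -[leLHS]mule1 -(@probability_setT _ _ _ P) -integral_cst//.
by apply: ge0_le_integral => // t _; rewrite lee_fin.
Qed.

Lemma outer_prob_ge0 A : 0 <= outer_prob P A.
Proof. by apply: outer_expectation_ge0 => t; rewrite lee_fin. Qed.

Lemma le_outer_prob A B : A `<=` B -> outer_prob P A <= outer_prob P B.
Proof.
move=> AB; apply: le_outer_expectation => t; rewrite lee_fin !indicE.
by rewrite ler_nat; case: (boolP (t \in A)) => // /set_mem/AB/mem_set ->.
Qed.

Lemma outer_prob_le1 A : outer_prob P A <= 1.
Proof.
rewrite -(@outer_expectation_cst 1)//; apply: le_outer_expectation => t.
by rewrite lee_fin indicE lern1; case: (_ \in _).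
Qed.

Lemma outer_probU A B :
  outer_prob P (A `|` B) <= outer_prob P A + outer_prob P B.
Proof.
apply: le_trans (outer_expectationD _ _) => [|t|t].
- apply: le_outer_expectation => t; rewrite -EFinD lee_fin !indicE in_setU.
  by rewrite -natrD ler_nat; case: (t \in A); case: (t \in B).
- by rewrite lee_fin.
- by rewrite lee_fin.
Qed.

Lemma outer_markov f (e : R) : (0 < e)%R -> (forall t, 0 <= f t) ->
  outer_prob P [set t | e%:E <= f t] <= (e^-1)%:E * outer_expectation P f.
Proof.
move=> e0 f0; apply: le_trans (outer_expectation_scale_le _ _); rewrite ?invr_gt0//.
apply: le_outer_expectation => t; rewrite indicE.
have [/set_mem/= et|_] := boolP (t \in _).
  apply: (@le_trans _ _ (e^-1 * e)%:E); first by rewrite mulVf ?gt_eqF.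
  by rewrite EFinM lee_wpmul2l// lee_fin invr_ge0 ltW.
by rewrite mule_ge0// lee_fin invr_ge0 ltW.
Qed.

End outer_calculus.

Section negligible_sequences.
Local Open Scope ereal_scope.
Context (R : realType) (d : nat -> measure_display)
  (T : forall n, measurableType (d n)) (P : forall n, probability (T n) R).
Implicit Types (A B : forall n, set (T n)) (Y : forall n, T n -> \bar R).

(** Convergence in outer probability is expressed through such sequences of
    sets, so that limit arguments become inclusions of sets. *)
Definition outer_negligible A := (fun n => outer_prob (P n) (A n)) @ \oo --> 0.

Lemma outer_negligibleP A : outer_negligible A <->
  forall e : R, (0 < e)%R -> \forall n \near \oo, outer_prob (P n) (A n) <= e%:E.
Proof.
split=> [A0 e e0|A0].
  move/fine_cvgP : A0 => [Af /cvgrPdist_le/(_ _ e0)].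
  apply: filterS2 Af => n Af; rewrite sub0r normrN => Ae.
  by rewrite -(fineK Af) lee_fin; exact: le_trans (ler_norm _) Ae.
apply/fine_cvgP; split.
  near=> n; rewrite ge0_fin_numE ?outer_prob_ge0//.
  exact: le_lt_trans (outer_prob_le1 _ _) (ltry _).
apply/cvgrPdist_le => e e0; apply: filterS (A0 _ e0) => n Ae.
rewrite sub0r normrN ger0_norm ?fine_ge0 ?outer_prob_ge0//.
rewrite -lee_fin fineK// ge0_fin_numE ?outer_prob_ge0//.
exact: le_lt_trans (outer_prob_le1 _ _) (ltry _).
Unshelve. all: by end_near. Qed.

Lemma outer_negligibleS A B : (\forall n \near \oo, A n `<=` B n) ->
  outer_negligible B -> outer_negligible A.
Proof.
move=> AB /outer_negligibleP B0; apply/outer_negligibleP => e e0.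
apply: filterS2 AB (B0 _ e0) => n AB; exact/le_trans/le_outer_prob.
Qed.

Lemma outer_negligibleU A B : outer_negligible A -> outer_negligible B ->
  outer_negligible (fun n => A n `|` B n).
Proof.
move=> /outer_negligibleP A0 /outer_negligibleP B0; apply/outer_negligibleP => e e0.
have e20 : (0 < e / 2)%R by rewrite divr_gt0.
apply: filterS2 (A0 _ e20) (B0 _ e20) => n Ae Be.
by rewrite (le_trans (outer_probU _ _ _))// (splitr e) EFinD leeD.
Qed.

End negligible_sequences.

(** * The standard normal law *)

Section standard_normal.
Context (R : realType).
Notation mu := (@lebesgue_measure R).
Notation phi := (normal_pdf (0 : R) 1).
Notation N := (@normal_prob R 0 1).

Lemma std_normal_pdfE (t : R) : phi t = normal_peak 1 * expR (- (t ^+ 2 / 2)).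
Proof.
rewrite normal_pdfE ?oner_neq0//; congr (_ * expR _).
by rewrite subr0 expr1n mulNr.
Qed.

Lemma std_normal_pdf_even (t : R) : phi (- t) = phi t.
Proof. by rewrite !std_normal_pdfE sqrrN. Qed.

Lemma is_derive_std_normal_pdf (t : R) :
  is_derive t (1 : R) (- phi) (t * phi t).
Proof.
have -> : - phi = - normal_peak 1 \*: (expR \o (fun u : R => - (u ^+ 2 / 2))).
  apply/funext => u; rewrite fctE /= std_normal_pdfE /GRing.scale/=.
  by ring.
have D : is_derive t (1 : R) (fun u : R => - (u ^+ 2 / 2)) (- t).
  have -> : (fun u : R => - (u ^+ 2 / 2)) = - 2^-1 \*: (id ^+ 2).
    apply/funext => u; have h : - (u ^+ 2 / 2) = - 2^-1 * u ^+ 2 by ring.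
    exact: h.
  apply: is_derive_eq; rewrite /= expr1.
  have h : - 2^-1 * (2 * t * 1) = - t by field.
  exact: h.
have D2 := @is_derive1_comp _ expR _ t _ _ (is_derive_expR _) D.
have D3 := is_deriveZ (- normal_peak 1) D2.
apply: (is_derive_eq D3).
rewrite std_normal_pdfE.
set E := expR _; have h : - normal_peak 1 * (E * - t) = t * (normal_peak 1 * E) by ring.
exact: h.
Qed.

Lemma continuous_std_normal_pdf : continuous phi.
Proof. exact/continuous_normal_pdf/oner_neq0. Qed.

(** Bounds the boundary term of the integration by parts below; it comes from
    [expR (- x) * x <= 1]. *)
Lemma std_normal_pdf_mul_le (t : R) : 0 < t -> t * phi t <= 2 * normal_peak 1 / t.
Proof.
move=> t0; rewrite std_normal_pdfE ler_pdivlMr//.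
have : expR (- (t ^+ 2 / 2)) * (t ^+ 2 / 2) <= 1.
  rewrite expRN mulrC ler_pdivrMr ?expR_gt0// mul1r.
  by rewrite (le_trans _ (expR_ge1Dx _))// lerDr.
have := normal_peak_ge0 (1 : R).
set p := normal_peak 1; set E := expR _; nra.
Qed.

(** Integration by parts, from [(- phi)' t = t * phi t]. *)
Lemma std_normal_second_moment_itv (a : R) : 0 < a ->
  (\int[mu]_(t in `[(- a)%R, a]) (t ^+ 2 * phi t)%:E =
   \int[mu]_(t in `[(- a)%R, a]) (phi t)%:E - (2 * (a * phi a))%:E)%E.
Proof.
move=> a0; have aa : - a < a by lra.
have cN : continuous (- phi : R -> R).
  by move=> t; apply: cvgN; exact: continuous_std_normal_pdf.
have := @integration_by_parts R id (- phi) (cst 1) (fun t => t * phi t) (- a) a aa.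
rewrite (_ : (fun x => (id x * (x * phi x))%:E) = (fun t => (t ^+ 2 * phi t)%:E)); last first.
  by apply/funext => t; rewrite /= mulrA -expr2.
move=> ->; first last.
- by move=> t _; rewrite derive1E; apply: derive_val; exact: is_derive_std_normal_pdf.
- split.
  + by move=> t _; have [] := is_derive_std_normal_pdf t.
  + by apply: cvg_at_right_filter; exact: cN.
  + by apply: cvg_at_left_filter; exact: cN.
- apply: continuous_subspaceT => t; apply: cvgM; first exact: cvg_id.
  exact: continuous_std_normal_pdf.
- by move=> t _; rewrite derive1E derive_id.
- split.
  + by move=> t _; exact: derivable_id.
  + by apply: cvg_at_right_filter; exact: cvg_id.
  + by apply: cvg_at_left_filter; exact: cvg_id.
- by apply: continuous_subspaceT => t; exact: cvg_cst.
rewrite /= (_ : (fun x => _) = (fun t => - (phi t)%:E)%E); last first.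
  by apply/funext => t; rewrite mul1r EFinN.
rewrite integralN/=; last first.
  apply: integrable_add_def => //; apply: continuous_compact_integrable.
    exact: segment_compact.
  exact/continuous_subspaceT/continuous_std_normal_pdf.
rewrite oppeK addeC; congr (_ + _%:E)%E; rewrite !fctE std_normal_pdf_even; ring.
Qed.


Let mphi : measurable_fun setT (EFin \o phi).
Proof. by apply/measurable_EFinP; exact: measurable_normal_pdf. Qed.

Let msqphi : measurable_fun [set: R] (fun t : R => (t ^+ 2 * phi t)%:E).
Proof.
apply/measurable_EFinP/measurable_funM; first exact: measurable_funX.
exact: measurable_normal_pdf.
Qed.

(** Let [a] tend to infinity in the previous identity; the boundary term is
    [O(1 / a)]. *)
Lemma std_normal_second_moment : (\int[mu]_t (t ^+ 2 * phi t)%:E = 1)%E.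
Proof.
pose F (n : nat) : set R := `[(- n.+1%:R)%R, n.+1%:R]%classic.
have ndF : nondecreasing_seq F.
  move=> m n mn; apply/subsetPset; apply: subset_itv; rewrite bnd_simp ?lerN2.
    by rewrite ler_nat.
  by rewrite ler_nat.
have FT : \bigcup_n F n = setT.
  apply/seteqP; split => // t _; exists (Num.truncn `|t|) => //=.
  by rewrite /F/= in_itv/= -ler_norml ltW//; have /andP[] := truncn_itv (normr_ge0 t).
have cv (f : R -> R) : (forall t, 0 <= f t) -> measurable_fun [set: R] (EFin \o f) ->
    (\int[mu]_(t in F n) (f t)%:E @[n --> \oo] --> \int[mu]_t (f t)%:E)%E.
  move=> f0 mf; rewrite -FT; apply: ge0_nondecreasing_set_cvg_integral => //.
  - by move=> n; exact: measurable_itv.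
  - by move=> n; exact: measurable_funTS.
  - by move=> n t _; rewrite lee_fin.
have := cv phi (@normal_pdf_ge0 _ _ _) mphi; rewrite integral_normal_pdf => cv1.
have := cv (fun t => t ^+ 2 * phi t) _ msqphi => /(_ _)/cvg_unique; apply => //.
  by move=> t; rewrite mulr_ge0 ?sqr_ge0 ?normal_pdf_ge0.
have c0 : (2 * (n.+1%:R * phi n.+1%:R))%:E @[n --> \oo] --> (0%R)%:E.
  apply: cvg_EFin; first exact: nearW.
  apply: (@squeeze_cvgr _ _ _ _ (cst 0) (fun n => 4 * normal_peak 1 * n.+1%:R^-1)).
  - near=> n; rewrite mulr_ge0 ?mulr_ge0 ?normal_pdf_ge0//=.
    have := @std_normal_pdf_mul_le n.+1%:R (ltr0Sn _ _).
    rewrite /= (_ : 4 * normal_peak 1 / n.+1%:R = 2 * (2 * normal_peak 1 / n.+1%:R)).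
      by rewrite ler_pM2l.
    by ring.
  - exact: cvg_cst.
  - rewrite -[X in _ --> X](mulr0 (4 * normal_peak 1)).
    by apply: cvgMl_tmp; exact: cvg_harmonic.
have cB : (1 +? - (0%:E : \bar R))%E by [].
have e n : (\int[mu]_(t in F n) (t ^+ 2 * phi t)%:E =
    \int[mu]_(t in F n) (phi t)%:E - (2 * (n.+1%:R * phi n.+1%:R))%:E)%E.
  by rewrite /F std_normal_second_moment_itv ?ltr0Sn.
rewrite /= (funext e); have := cvgeB cB cv1 c0; rewrite sube0; exact.
Unshelve. all: by end_near. Qed.

Lemma measurable_normr_ge (e : R) : measurable [set t : R | (e <= `|t|)%R].
Proof.
rewrite (_ : [set _ | _] = setT `&` (fun t : R => `|t|) @^-1` `[e, +oo[%classic).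
  have mn : measurable_fun [set: R] (fun t : R => `|t|) by exact: normr_measurable.
  exact: mn.
by apply/seteqP; split => t /=; rewrite in_itv/= andbT => // -[].
Qed.

(** Chebyshev's inequality, with second moment [1]. *)
Lemma std_normal_tail (e : R) : 0 < e ->
  (N [set t | (e <= `|t|)%R] <= ((e ^+ 2)^-1)%:E)%E.
Proof.
move=> e0; set A := [set t | _]; have mA : measurable A := measurable_normr_ge e.
have e20 : 0 < e ^+ 2 by rewrite exprn_gt0.
rewrite -(@lee_pmul2l _ (e ^+ 2)%:E)// ?lte_fin// -EFinM divff ?gt_eqF//.
rewrite -std_normal_second_moment /normal_prob.
rewrite -ge0_integralZl_EFin//; last 3 first.
- by move=> t _; rewrite lee_fin normal_pdf_ge0.
- exact: measurable_funTS.
- exact: ltW.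
apply: (@le_trans _ _ (\int[mu]_(t in A) (t ^+ 2 * phi t)%:E)%E).
  apply: ge0_le_integral => //.
  - by move=> t _; rewrite mule_ge0 ?lee_fin ?normal_pdf_ge0// ltW.
  - by apply: measurable_funTS; exact: measurable_funeM.
  - exact: measurable_funTS.
  - move=> t At; rewrite -EFinM lee_fin ler_wpM2r ?normal_pdf_ge0//.
    by rewrite -(real_normK (num_real t)) lerXn2r// nnegrE ltW.
apply: ge0_subset_integral => //.
by move=> t _; rewrite lee_fin mulr_ge0 ?sqr_ge0 ?normal_pdf_ge0.
Qed.

End standard_normal.

Section standard_normal_integrals.
Context (R : realType).
Notation mu := (@lebesgue_measure R).
Notation phi := (normal_pdf (0 : R) 1).
Notation N := (@normal_prob R 0 1).

Let mphi : measurable_fun [set: R] (EFin \o phi).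
Proof. by apply/measurable_EFinP; exact: measurable_normal_pdf. Qed.

(** The density is a version of the Radon-Nikodym derivative; boundedness of
    [f] ensures integrability. *)
Lemma integral_std_normal_bounded (f : R -> R) (C : R) :
  measurable_fun [set: R] f -> (forall t, 0 <= f t <= C) ->
  (\int[N]_t (f t)%:E = \int[mu]_t (f t * phi t)%:E)%E.
Proof.
move=> mf f0C.
have domN := @normal_prob_dominates R 0 1.
under [RHS]eq_integral do rewrite EFinM.
rewrite -(Radon_Nikodym_change_of_variables domN)//=; last first.
  apply: (@le_integrable _ _ _ N setT measurableT _ (cst C%:E)).
  - exact/measurable_EFinP.
  - move=> t _; have /andP[f0 fC] := f0C t.
    by rewrite /= lee_fin !ger0_norm// (le_trans f0).
  - exact: finite_measure_integrable_cst.
apply: ae_eq_integral => //.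
- apply: emeasurable_funM => //; first exact/measurable_EFinP.
- by apply: emeasurable_funM => //; exact/measurable_EFinP.
- apply: ae_eqe_mul2l => /=.
  rewrite Radon_NikodymE//=.
  case: cid => /= h [h1 h2 h3].
  apply: integral_ae_eq => //=.
  by move=> E E01 mE; rewrite -h3.
Qed.

(** For [0 <= m] this is the minimum of [x ^+ 2] and [m]; truncating before
    squaring makes the Lipschitz constant apparent. *)
Definition sqtrunc (m x : R) := (Num.min `|x| (Num.sqrt m)) ^+ 2.

Lemma sqtrunc_ge0 m x : 0 <= sqtrunc m x.
Proof. exact: sqr_ge0. Qed.

Lemma sqtrunc_le m x : 0 <= m -> sqtrunc m x <= m.
Proof.
move=> m0; rewrite -[leRHS]sqr_sqrtr// lerXn2r ?nnegrE ?le_min ?normr_ge0 ?sqrtr_ge0//.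
by rewrite ge_min lexx orbT.
Qed.

Lemma sqtrunc_le_sqr m x : sqtrunc m x <= x ^+ 2.
Proof.
rewrite -(real_normK (num_real x)) lerXn2r ?nnegrE ?le_min ?normr_ge0 ?sqrtr_ge0//.
by rewrite ge_min lexx.
Qed.

Lemma sqtrunc_eq m x : x ^+ 2 <= m -> sqtrunc m x = x ^+ 2.
Proof.
move=> xm; rewrite /sqtrunc min_l ?real_normK ?num_real//.
by rewrite -sqrtr_sqr ler_wsqrtr.
Qed.

Lemma sqtrunc_lipschitz m x y : 0 <= m ->
  `|sqtrunc m x - sqtrunc m y| <= 2 * Num.sqrt m * `|x - y|.
Proof.
move=> m0; rewrite /sqtrunc; set a := Num.min _ _; set b := Num.min _ _.
have s0 := sqrtr_ge0 m.
have ab : `|a - b| <= `|x - y|.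
  have := ler_dist_dist x y; rewrite !ler_norml.
  by rewrite /a /b !minEle; do 2 case: ifPn => ?; rewrite ?ler_norml; lra.
have a0 : 0 <= a by rewrite le_min normr_ge0.
have b0 : 0 <= b by rewrite le_min normr_ge0.
have am : a <= Num.sqrt m by rewrite ge_min lexx orbT.
have bm : b <= Num.sqrt m by rewrite ge_min lexx orbT.
rewrite subr_sqr normrM mulrC; apply: ler_pM => //.
by rewrite ger0_norm ?addr_ge0//; lra.
Qed.

Lemma measurable_sqtrunc m : measurable_fun [set: R] (sqtrunc m).
Proof.
by apply: measurable_funX; apply: measurable_minr.
Qed.

Lemma le_sqtrunc m m' x : m <= m' -> sqtrunc m x <= sqtrunc m' x.
Proof.
move=> mm; rewrite lerXn2r ?nnegrE ?le_min ?normr_ge0 ?sqrtr_ge0//.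
by rewrite !ge_min lexx ler_wsqrtr ?orbT.
Qed.

Lemma cvg_sqtrunc x : sqtrunc n%:R x @[n --> \oo] --> x ^+ 2.
Proof.
apply: (cvg_near_cst); near=> n; apply: sqtrunc_eq.
have /andP[_ /ltW xn] := truncn_itv (sqr_ge0 x).
rewrite (le_trans xn)// ler_nat; near: n; exact: nbhs_infty_ge.
Unshelve. all: by end_near. Qed.

Lemma std_normal_trunc_moment_cvg (s : R) :
  (\int[N]_t (sqtrunc n%:R (s * t))%:E)%E @[n --> \oo] --> (s ^+ 2)%:E.
Proof.
have ms n : measurable_fun [set: R] (fun t => sqtrunc n (s * t)).
  apply: (measurableT_comp (measurable_sqtrunc n)).
  exact: measurable_funM.
have -> : (fun n : nat => \int[N]_t (sqtrunc n%:R (s * t))%:E)%E =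
    (fun n : nat => \int[mu]_t (sqtrunc n%:R (s * t) * phi t)%:E)%E.
  apply/funext => n; apply: (@integral_std_normal_bounded _ n%:R) => // t.
  by rewrite sqtrunc_ge0 sqtrunc_le.
have -> : (s ^+ 2)%:E = (\int[mu]_t ((s * t) ^+ 2 * phi t)%:E)%E.
  under eq_integral do rewrite exprMn -mulrA EFinM.
  rewrite ge0_integralZl_EFin ?sqr_ge0// ?std_normal_second_moment ?mule1//.
  - by move=> t _; rewrite lee_fin mulr_ge0 ?sqr_ge0 ?normal_pdf_ge0.
  - apply/measurable_EFinP/measurable_funM; first exact: measurable_funX.
    exact: measurable_normal_pdf.
pose g n t : \bar R := (sqtrunc n%:R (s * t) * phi t)%:E.
rewrite [X in _ --> X](_ : _ = \int[mu]_t limn (g ^~ t))%E; last first.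
  apply: eq_integral => t _; apply/esym/cvg_lim => //.
  apply: cvg_EFin; first exact: nearW.
  by apply: cvgM; [exact: cvg_sqtrunc|exact: cvg_cst].
apply: (@cvg_monotone_convergence _ _ _ mu setT measurableT g).
- move=> n; apply/measurable_EFinP; apply: measurable_funM; first exact: ms.
  exact: measurable_normal_pdf.
- by move=> n t _; rewrite lee_fin mulr_ge0 ?sqtrunc_ge0 ?normal_pdf_ge0.
- move=> t _ m n mn; rewrite lee_fin ler_wpM2r ?normal_pdf_ge0//.
  by rewrite le_sqtrunc// ler_nat.
Qed.

End standard_normal_integrals.

Section standard_normal_cdf.
Context (R : realType).
Notation mu := (@lebesgue_measure R).
Notation phi := (normal_pdf (0 : R) 1).
Notation N := (@normal_prob R 0 1).
Implicit Types s t a b e p : R.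

Lemma std_normal_itv_le a b : a <= b ->
  (N `[a, b]%classic <= (normal_peak 1 * (b - a))%:E)%E.
Proof.
move=> ab; rewrite /normal_prob.
apply: (@le_trans _ _ (\int[mu]_(t in `[a, b]) (normal_peak (1 : R))%:E)%E).
  apply: ge0_le_integral => //.
  - by move=> t _; rewrite lee_fin normal_pdf_ge0.
  - apply/measurable_EFinP; apply: measurable_funTS; exact: measurable_normal_pdf.
  - by move=> t _; rewrite lee_fin normal_pdf_ub ?oner_neq0.
rewrite integral_cst// EFinM lee_wpmul2l ?lee_fin ?normal_peak_ge0//.
rewrite [leLHS]lebesgue_measure_itv/= lte_fin.
by case: ltP => _; rewrite ?EFinB// lee_fin subr_ge0.
Qed.

Lemma std_normal_itvN a b : a <= b ->
  N `[(- b)%R, (- a)%R]%classic = N `[a, b]%classic.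
Proof.
move=> ab; rewrite /normal_prob integration_by_substitution_oppr//.
  by apply: eq_integral => t _; rewrite /= std_normal_pdf_even.
exact/continuous_subspaceT/continuous_std_normal_pdf.
Qed.

Definition std_normal_cdf t : R := fine (N `]-oo, t]%classic).

Lemma std_normal_cdfE t : (std_normal_cdf t)%:E = N `]-oo, t]%classic.
Proof. by rewrite fineK// fin_num_measure. Qed.

Lemma std_normal_cdf_nondecreasing s t : s <= t -> std_normal_cdf s <= std_normal_cdf t.
Proof.
move=> st; rewrite -lee_fin !std_normal_cdfE; apply: le_measure; rewrite ?inE//.
by apply: subset_itvl; rewrite bnd_simp.
Qed.

Lemma std_normal_itvE s t : s <= t ->
  N `[s, t]%classic = (std_normal_cdf t - std_normal_cdf s)%:E.
Proof.
move=> st.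
have N1 : N `[s, s]%classic = 0%E.
  apply/eqP; rewrite eq_le measure_ge0 andbT.
  by rewrite (le_trans (std_normal_itv_le (lexx s)))// subrr mulr0.
have e u : s <= u -> N `]-oo, u]%classic = (N `]-oo, s[%classic + N `[s, u]%classic)%E.
  move=> su; rewrite -measureU//=.
  - by rewrite -(@itv_bndbnd_setU _ _ _ (BLeft s)) ?bnd_simp.
  - by apply/seteqP; split => // x /= []; rewrite !in_itv/= => xs /andP[]; rewrite leNgt xs.
have := e _ (lexx s); rewrite N1 adde0 -std_normal_cdfE => es.
have := e _ st; rewrite -std_normal_cdfE -es EFinB => ->.
by rewrite addeAC subee ?add0e.
Qed.

Lemma std_normal_cdf_lipschitz s t : s <= t ->
  std_normal_cdf t <= std_normal_cdf s + normal_peak 1 * (t - s).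
Proof.
move=> st; rewrite -lerBlDl -lee_fin -std_normal_itvE//.
exact: std_normal_itv_le.
Qed.

Lemma std_normal_cdfN_le e : 0 < e -> std_normal_cdf (- e) <= (e ^+ 2)^-1.
Proof.
move=> e0; rewrite -lee_fin std_normal_cdfE (le_trans _ (std_normal_tail e0))//.
apply: le_measure; rewrite ?inE//; last first.
  move=> t /=; rewrite in_itv/= => te; rewrite ler0_norm; lra.
exact: measurable_normr_ge.
Qed.

Lemma std_normal_cdf_ge e : 0 < e -> 1 - (e ^+ 2)^-1 <= std_normal_cdf e.
Proof.
move=> e0; rewrite lerBlDr -lee_fin EFinD std_normal_cdfE.
rewrite (le_trans _ (leeD (lexx _) (std_normal_tail e0)))//.
rewrite -(@probability_setT _ _ _ N).
apply: le_trans (measureU2 _ _ _) => //; last exact: measurable_normr_ge.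
apply: le_measure; rewrite ?inE//.
  by apply: measurableU => //; exact: measurable_normr_ge.
move=> t _ /=; rewrite in_itv/=; have [|et] := leP t e; first by left.
by right; rewrite ler_normr (ltW et).
Qed.

(** The quantile is an infimum; both inequalities follow from approaching it
    from either side, as the distribution function is Lipschitz. *)
Lemma std_normal_cdf_quantile p : 0 < p < 1 -> std_normal_cdf (normal_quantile p) = p.
Proof.
move=> /andP[p0 p1]; rewrite /normal_quantile.
set S := [set t | _]; have SE t : S t <-> p <= std_normal_cdf t.
  by rewrite /S/= -std_normal_cdfE lee_fin.
have S0 : S !=set0.
  exists (1 - p)^-1; apply/SE.
  rewrite (le_trans _ (std_normal_cdf_ge _)) ?invr_gt0 ?subr_gt0// exprVn invrK; nra.
have lS : lbound S (- (2 / p)).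
  move=> t /SE pt; rewrite leNgt; apply/negP => /ltW tp.
  have := std_normal_cdf_nondecreasing tp; have := @std_normal_cdfN_le (2 / p) (divr_gt0 _ p0).
  rewrite ltr0n => /(_ isT).
  have -> : (2 / p) ^- 2 = p ^+ 2 / 4 by field; rewrite gt_eqF.
  nra.
have hS : has_inf S by split => //; exists (- (2 / p)).
have pk0 := @normal_peak_gt0 R 1 (oner_neq0 _).
apply/eqP; rewrite eq_le; apply/andP; split; apply/ler_addgt0Pr => e e0;
  have d0 : 0 < e / normal_peak 1 by rewrite divr_gt0.
- have zl : inf S - e / normal_peak 1 <= inf S by rewrite gerBl ltW.
  rewrite (le_trans (std_normal_cdf_lipschitz zl))// subKr mulrCA divff ?gt_eqF// mulr1.
  rewrite lerD2r leNgt; apply/negP => /ltW/SE Sz.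
  by have := ge_inf (proj2 hS) Sz; rewrite leNgt ltrBlDr ltrDl d0.
- have [t St tz] := inf_adherent d0 hS.
  move/SE : (St) => pt; have zt := ge_inf (proj2 hS) St.
  rewrite (le_trans pt)// (le_trans (std_normal_cdf_lipschitz zt))// lerD2l.
  by rewrite mulrC -ler_pdivlMr// lerBlDl ltW.
Qed.

Lemma normal_quantile_itv (alpha beta : R) : 0 < alpha < 1 -> 0 < beta < 1 ->
  alpha + beta < 1 ->
  N `[(- normal_quantile (1 - alpha))%R, (- normal_quantile beta)%R]%classic =
    (1 - alpha - beta)%:E.
Proof.
move=> /andP[a0 a1] /andP[b0 b1] ab.
have Pa : std_normal_cdf (normal_quantile (1 - alpha)) = 1 - alpha.
  by apply: std_normal_cdf_quantile; apply/andP; split; lra.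
have Pb : std_normal_cdf (normal_quantile beta) = beta.
  by apply: std_normal_cdf_quantile; rewrite b0.
have qq : normal_quantile beta <= normal_quantile (1 - alpha).
  rewrite leNgt; apply/negP => /ltW/std_normal_cdf_nondecreasing; rewrite Pa Pb; lra.
by rewrite std_normal_itvN// std_normal_itvE// Pa Pb.
Qed.

End standard_normal_cdf.

(** * Brownian bridges *)

Section linf_measurability.
Context (R : realType) (I : Type).

Lemma linf_lipschitz_continuous (h : linf R I -> R) (c : R) :
  (forall z y, `|h z - h y| <= c * `|z - y|) -> continuous h.
Proof.
move=> hl z; apply/(@cvgrPdist_le _ _ _ _ (nbhs_filter z)) => e e0.
have c1 : 0 < `|c| + 1 by rewrite ltr_wpDl.
near=> y; apply: (le_trans (hl _ _)).
apply: (@le_trans _ _ ((`|c| + 1) * `|z - y|)).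
  by rewrite ler_wpM2r// (le_trans (ler_norm _))// lerDl.
rewrite mulrC -ler_pdivlMr//; near: y.
by apply: cvgr_dist_le => //; rewrite divr_gt0.
Unshelve. all: by end_near. Qed.

Lemma open_measurable_linf (A : set (linf R I)) :
  open A -> measurable (A : set (borel_linf R I)).
Proof. by move=> oA; exact: sub_sigma_algebra. Qed.

Lemma closed_measurable_linf (A : set (linf R I)) :
  closed A -> measurable (A : set (borel_linf R I)).
Proof.
move=> cA; rewrite -[A]setCK; apply: measurableC.
by apply: open_measurable_linf; rewrite openC.
Qed.

Lemma continuous_measurable_linf (h : linf R I -> R) :
  continuous h -> measurable_fun [set: borel_linf R I] (h : borel_linf R I -> R).
Proof.
move=> ch; apply: (measurability _ (RGenOInfty.measurableE R)) => //.
move=> /= _ [_ [a ->] <-]; rewrite setTI; apply: open_measurable_linf.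
by move/continuousP : ch; apply; exact: rray_open.
Qed.

Lemma linf_eval_le (z y : linf R I) i : `|z i - y i| <= `|z - y|.
Proof. exact: (supnorm_ub (z - y) i). Qed.

Lemma measurable_increment_ge (i j : I) (e : R) :
  measurable ([set z : linf R I | e <= `|z i - z j|] : set (borel_linf R I)).
Proof.
pose h (z : linf R I) := `|z i - z j|.
have ch : continuous h.
  apply: (@linf_lipschitz_continuous _ 2) => z y.
  rewrite /h (le_trans (ler_dist_dist _ _))//.
  have -> : z i - z j - (y i - y j) = (z i - y i) - (z j - y j) by ring.
  by rewrite (le_trans (ler_normB _ _))// mulrDl mul1r lerD// linf_eval_le.
have := continuous_measurable_linf ch measurableT (measurable_itv `[e, +oo[).
by rewrite setTI; congr measurable; apply/seteqP; split => z /=; rewrite in_itv/= andbT.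
Qed.

Section oscillation.
Variables (A : set I) (i0 : I).

Let osc_fun (z : linf R I) i : R := (z i - z i0) * \1_A i.

Let osc_bounded z : osc_fun z \in @linf_pred R I.
Proof.
apply/linf_boundP; exists (supnorm z + supnorm z) => i.
rewrite normrM (@le_trans _ _ (`|z i - z i0| * 1))//.
  by rewrite ler_wpM2l// ger0_norm// indicE lern1; case: (_ \in _).
by rewrite mulr1 (le_trans (ler_normB _ _))// lerD// supnorm_ub.
Qed.

(** The increments of a path from the index [i0], restricted to the indices in
    [A], form a bounded function again, so that their supremum is a norm in
    [linf R I] and depends on the path in a Lipschitz way. *)
Definition oscillation_at z : linf R I := Linf (osc_bounded z).

Lemma oscillation_lipschitz z y : `| `|oscillation_at z| - `|oscillation_at y| | <= 2 * `|z - y|.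
Proof.
apply: (le_trans (ler_dist_dist _ _)).
apply: supnorm_le => [|i]; first by rewrite mulr_ge0.
have -> : (oscillation_at z - oscillation_at y) i = ((z i - y i) - (z i0 - y i0)) * \1_A i.
  by transitivity (osc_fun z i - osc_fun y i) => //; rewrite /osc_fun; ring.
rewrite normrM (@le_trans _ _ (`|z i - y i - (z i0 - y i0)| * 1))//.
  by rewrite ler_wpM2l// ger0_norm// indicE lern1; case: (_ \in _).
rewrite mulr1 mulr2n mulrDl mul1r (le_trans (ler_normB _ _))//.
by rewrite lerD// linf_eval_le.
Qed.

Lemma oscillation_ge (z : linf R I) i : A i -> `|z i - z i0| <= `|oscillation_at z|.
Proof.
move=> Ai; have := supnorm_ub (oscillation_at z) i.
by rewrite /= /osc_fun indicE mem_set// mulr1.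
Qed.

Lemma oscillation_le (z : linf R I) (c : R) : 0 <= c -> (forall i, A i -> `|z i - z i0| <= c) ->
  `|oscillation_at z| <= c.
Proof.
move=> c0 zc; apply: supnorm_le => // i; rewrite /= /osc_fun indicE.
have [/set_mem Ai|_] := boolP (i \in A); first by rewrite mulr1 zc.
by rewrite mulr0 normr0.
Qed.

End oscillation.
End linf_measurability.

Section bridge.
Context d (X : measurableType d) (R : realType) (P : probability X R).
Context (F : set (X -> R)) (mF : forall f, F f -> measurable_fun setT f).
Context (L : probability (borel_linf R F) R) (PL : brownian_bridge P L).
Notation N := (@normal_prob R 0 1).

(** Dividing the coefficients by the standard deviation [s] of the linear
    combination reduces every law to the standard normal one; for [s = 0] both
    sides are the Dirac mass at [0]. *)
Lemma bridge_lincomb_law k (f : 'I_k -> F) (a : 'I_k -> R) (A : set R) :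
  measurable A ->
  let s := Num.sqrt (\sum_(i < k) \sum_(j < k)
          a i * a j * covariance_under P (set_val (f i)) (set_val (f j))) in
  L [set z : linf R F | A (\sum_(i < k) a i * z (f i))] =
  N [set t | A (s * t)].
Proof.
move=> mA s; have [_ _ PLlaw] := PL.
have [s0|s0] := eqVneq s 0.
  rewrite PLlaw// -/s /centered_normal s0 eqxx diracE.
  have [A0|A0] := boolP (_ \in A).
    rewrite (_ : [set _ | _] = setT) ?probability_setT//.
    by apply/seteqP; split => // t _ /=; rewrite mul0r; exact: set_mem.
  rewrite (_ : [set _ | _] = set0) ?measure0//.
  by apply/seteqP; split => // t /=; rewrite mul0r => /mem_set; rewrite (negbTE A0).
have V0 : 0 < \sum_(i < k) \sum_(j < k)
    a i * a j * covariance_under P (set_val (f i)) (set_val (f j)).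
  by rewrite -sqrtr_gt0 lt_neqAle eq_sym s0 sqrtr_ge0.
have mA' : measurable [set t : R | A (s * t)].
  have ms : measurable_fun [set: R] (fun t : R => s * t) by exact: measurable_funM.
  by rewrite -[X in measurable X]setTI; exact: ms.
have := PLlaw k f (fun i => s^-1 * a i) _ mA'.
rewrite [X in centered_normal X](_ : _ = 1); last first.
  rewrite -(sqrtr1 R); congr Num.sqrt.
  have s2 := sqr_sqrtr (ltW V0); rewrite -/s in s2.
  transitivity ((s ^+ 2)^-1 * s ^+ 2); last by rewrite mulVf// expf_eq0.
  rewrite [in X in _ * X]s2 mulr_sumr; apply: eq_bigr => i _.
  rewrite mulr_sumr; apply: eq_bigr => j _; rewrite -exprVn expr2; ring.
rewrite /centered_normal oner_eq0 => <-; congr (L _).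
have e (z : linf R F) : s * (\sum_(i < k) s^-1 * a i * z (f i)) = \sum_(i < k) a i * z (f i).
  by rewrite mulr_sumr; apply: eq_bigr => i _; rewrite -mulrA mulVKf.
by apply/seteqP; split => z /=; rewrite e.
Qed.

Lemma bridge_marginal (f : F) (A : set R) : measurable A ->
  L [set z : linf R F | A (z f)] =
  N [set t | A (Num.sqrt (covariance_under P (set_val f) (set_val f)) * t)].
Proof.
move=> mA; have := @bridge_lincomb_law 1 (fun=> f) (fun=> 1) A mA.
rewrite !big_ord1 !mul1r => <-; congr (L _).
by apply/seteqP; split => z /=; rewrite big_ord1 mul1r.
Qed.

Lemma square_integrableM (f g : X -> R) :
  measurable_fun setT f -> measurable_fun setT g ->
  P.-integrable setT (fun x => (f x ^+ 2)%:E) ->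
  P.-integrable setT (fun x => (g x ^+ 2)%:E) ->
  P.-integrable setT (fun x => (f x * g x)%:E).
Proof.
move=> mf mg f2 g2.
apply: (@le_integrable _ _ _ P setT measurableT _ (fun x => (f x ^+ 2)%:E + (g x ^+ 2)%:E)%E).
- by apply/measurable_EFinP/measurable_funM.
- move=> x _; rewrite -EFinD /= lee_fin [leRHS]ger0_norm ?addr_ge0 ?sqr_ge0//.
  rewrite normrM -(real_normK (num_real (f x))) -(real_normK (num_real (g x))).
  have := sqr_ge0 (`|f x| - `|g x|); have := sqr_ge0 `|f x|; have := sqr_ge0 `|g x|.
  rewrite sqrrB; set u := `|f x|; set v := `|g x|; lra.
- exact: integrableD.
Qed.

(** The left-hand side is the variance of [f - g], hence at most its second
    moment. *)
Lemma covariance_under_diff_le (f g : X -> R) :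
  measurable_fun setT f -> measurable_fun setT g ->
  P.-integrable setT (fun x => (f x ^+ 2)%:E) ->
  P.-integrable setT (fun x => (g x ^+ 2)%:E) ->
  covariance_under P f f - covariance_under P f g
    - covariance_under P g f + covariance_under P g g <=
  \int[P]_x ((f x - g x) ^+ 2).
Proof.
move=> mf mg f2 g2; rewrite /covariance_under.
have fg := square_integrableM mf mg f2 g2.
have ff := square_integrableM mf mf f2 f2.
have gg := square_integrableM mg mg g2 g2.
rewrite (_ : \int[P]_x ((f x - g x) ^+ 2) = \int[P]_x (f x * f x)
   - \int[P]_x (f x * g x) - (\int[P]_x (f x * g x) - \int[P]_x (g x * g x))); last first.
  have iB (u v : X -> R) : P.-integrable setT (EFin \o u) ->
      P.-integrable setT (EFin \o v) ->
      P.-integrable setT (EFin \o (fun x => u x - v x)).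
    by move=> iu iv; exact: (integrableB measurableT iu iv).
  rewrite -(RintegralB measurableT ff fg) -(RintegralB measurableT fg gg).
  rewrite -(RintegralB measurableT (iB _ _ ff fg) (iB _ _ fg gg)).
  by congr Rintegral; apply/funext => x; ring.
rewrite (_ : \int[P]_x (g x * f x) = \int[P]_x (f x * g x)); last first.
  by congr Rintegral; apply/funext => x; rewrite mulrC.
have := sqr_ge0 (\int[P]_x f x - \int[P]_x g x); rewrite sqrrB.
set a := \int[P]_x f x; set b := \int[P]_x g x.
lra.
Qed.


Lemma Lnorm2_lt (f : X -> R) (c : R) : measurable_fun setT f ->
  ('N[P]_2%:E[EFin \o f] < c%:E)%E -> \int[P]_x (f x ^+ 2) < c ^+ 2.
Proof.
move=> mf; rewrite unlock /=.
rewrite (eq_integral (fun x => (f x ^+ 2)%:E)); last first.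
  move=> x _; rewrite /= powR_mulrn// real_normK ?num_real//.
rewrite /Rintegral; set I := (\int[P]_x _)%E.
have : (0 <= I)%E by apply: integral_ge0 => x _; rewrite lee_fin sqr_ge0.
case: I => [r|_|//]; last by rewrite poweRyr ?invr_gt0// ltNge leey.
rewrite lee_fin => r0; rewrite poweR_EFin lte_fin powR12_sqrt//= => rc.
have c0 : 0 < c := le_lt_trans (sqrtr_ge0 _) rc.
by rewrite -[ltLHS]sqr_sqrtr// ltrXn2r ?nnegrE ?sqrtr_ge0// ltW.
Qed.

(** Chebyshev's inequality for the normal variable [z f - z g], whose variance
    is at most the squared [L_2] distance of [f] and [g]. *)
Lemma bridge_increment_le (f g : F) (e c : R) : 0 < e ->
  ('N[P]_2%:E[EFin \o (set_val f \- set_val g)%R] < c%:E)%E ->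
  (L [set z : linf R F | (e <= `|z f - z g|)%R] <= ((c / e) ^+ 2)%:E)%E.
Proof.
move=> e0 fgc; have [_ sq _] := PL.
have mf := mF (set_valP f); have mg := mF (set_valP g).
have := covariance_under_diff_le mf mg (sq f) (sq g).
have /(_ (measurable_funB mf mg)) := Lnorm2_lt _ fgc => fgc2 Vle.
(* the increment is the linear combination of [f] and [g] with coefficients
   [1] and [-1] *)
pose h (i : 'I_2) := if i == ord0 then f else g.
pose a (i : 'I_2) : R := if i == ord0 then 1 else -1.
set V := (X in X <= _) in Vle.
have VE : \sum_(i < 2) \sum_(j < 2) a i * a j *
    covariance_under P (set_val (h i)) (set_val (h j)) = V.
  by rewrite !big_ord_recl !big_ord0 /a /h /V /=; ring.
have := @bridge_lincomb_law 2 h a _ (measurable_normr_ge e).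
rewrite /= VE (_ : [set z : linf R F | _] = [set z | e <= `|z f - z g|]); last first.
  by apply/seteqP; split => z /=; rewrite big_ord_recl big_ord1 /a /h /= mul1r mulN1r.
move=> ->; set s := Num.sqrt V.
have sc : s ^+ 2 <= c ^+ 2.
  have [V0|V0] := leP 0 V; last by rewrite /s ler0_sqrtr ?(ltW V0)// expr0n sqr_ge0.
  by rewrite sqr_sqrtr// (le_trans Vle)// ltW.
have [s0|s0] := eqVneq s 0.
  rewrite (_ : [set _ | _] = set0) ?measure0 ?lee_fin ?sqr_ge0//.
  by apply/seteqP; split => // t /=; rewrite s0 mul0r normr0 leNgt e0.
have sp : 0 < s by rewrite lt_neqAle eq_sym s0 sqrtr_ge0.
rewrite (_ : [set _ | _] = [set t : R | e / s <= `|t|]); last first.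
  by apply/seteqP; split => t /=; rewrite normrM gtr0_norm// ler_pdivrMr// mulrC.
rewrite (le_trans (std_normal_tail _)) ?divr_gt0// lee_fin.
rewrite -exprVn invf_div !exprMn ler_wpM2r// exprn_ge0// invr_ge0 ltW//.
Qed.

(** A ball of positive mass meets every event whose complement has smaller
    mass; since increments between [f] and [f0] vary by less than four radii
    inside the ball, one path with a small increment makes all increments in the
    ball small. *)
Lemma bridge_ball_equicontinuous (f0 : F) (z0 : linf R F) (r : R) : 0 < r ->
  (0 < L (ball z0 r))%E ->
  exists2 dl : R, 0 < dl & forall f : F,
    ('N[P]_2%:E[EFin \o (set_val f \- set_val f0)%R] < dl%:E)%E ->
    forall z, ball z0 r z -> `|z f - z f0| <= 5 * r.
Proof.
move=> r0 B0; set p := fine (L (ball z0 r)).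
have mB : measurable (ball z0 r : set (borel_linf R F)).
  by apply: open_measurable_linf; exact: ball_open.
have pE : L (ball z0 r) = p%:E by rewrite fineK// fin_num_measure.
have p0 : 0 < p by rewrite -lte_fin -pE.
(* this radius makes the bound on the mass of large increments equal to [p / 4] *)
exists (r * (Num.sqrt p / 2)); first by rewrite mulr_gt0// divr_gt0// sqrtr_gt0.
move=> f fdl z Bz.
have [y [By ry]] : exists y : linf R F, ball z0 r y /\ `|y f - y f0| < r.
  apply: contrapT => /forallNP H.
  have := bridge_increment_le r0 fdl.
  rewrite (_ : _ ^+ 2 = p / 4); last first.
    by rewrite (mulrC r) mulfK ?gt_eqF// exprMn sqr_sqrtr ?(ltW p0)//; field.
  rewrite leNgt => /negP; apply; apply: (@lt_le_trans _ _ (L (ball z0 r))).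
    by rewrite pE lte_fin ltr_pdivrMr//; lra.
  apply: le_measure; rewrite ?inE//; last first.
    move=> y By /=; rewrite leNgt; apply/negP => yr; exact: (H y).
  exact: measurable_increment_ge.
have zy : `|z - y| < 2 * r.
  rewrite -(subrKA z0) (le_lt_trans (ler_normD _ _))//.
  by move: Bz By; rewrite -ball_normE /= distrC => Bz By; rewrite mulrDl mul1r ltrD.
have -> : z f - z f0 = (z f - y f) + (y f - y f0) - (z f0 - y f0) by ring.
have zyf := linf_eval_le z y f; have zyf0 := linf_eval_le z y f0.
rewrite (le_trans (ler_normB _ _))//.
have := ler_normD (z f - y f) (y f - y f0); lra.
Qed.

End bridge.

Section bridge_test.
Context d (X : measurableType d) (R : realType) (P : probability X R).
Context (F : set (X -> R)) (mF : forall f, F f -> measurable_fun setT f).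
Context (L : probability (borel_linf R F) R) (PL : brownian_bridge P L).

(** Balls of mass zero are collected in the exceptional set [Z]. *)
Lemma bridge_balls_equicontinuous (f0 : F) (r : R) (s : seq (linf R F)) :
  0 < r ->
  exists2 dl : R, 0 < dl & exists Z : set (borel_linf R F),
    [/\ measurable Z, L Z = 0%E & forall z0 z, z0 \in s -> ball z0 r z ->
    Z z \/ forall f : F,
    ('N[P]_2%:E[EFin \o (set_val f \- set_val f0)%R] < dl%:E)%E ->
    `|z f - z f0| <= 5 * r].
Proof.
move=> r0; elim: s => [|x s [dl dl0 [Z [mZ Z0 sZ]]]].
  by exists 1 => //; exists set0; split => //; rewrite measure0.
have mB : measurable (ball x r : set (borel_linf R F)).
  by apply: open_measurable_linf; exact: ball_open.
have [B0|B0] := eqVneq (L (ball x r)) 0%E.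
  exists dl => //; exists (Z `|` ball x r); split.
  - exact: measurableU.
  - by rewrite measureU0.
  - move=> z0 z; rewrite inE => /predU1P[->|z0s] Bz; first by left; right.
    by have [Zz|fz] := sZ _ _ z0s Bz; [left; left|right].
have Bgt : (0 < L (ball x r))%E by rewrite lt_neqAle eq_sym B0 measure_ge0.
have [dx dx0 xdx] := bridge_ball_equicontinuous mF PL f0 r0 Bgt.
exists (Num.min dl dx); first by rewrite lt_min dl0.
exists Z; split => // z0 z; rewrite inE => /predU1P[->|z0s] Bz.
  right => f; rewrite EFin_min lt_min => /andP[_ fdx]; exact: xdx.
have [Zz|fz] := sZ _ _ z0s Bz; [by left|right => f].
by rewrite EFin_min lt_min => /andP[fdl _]; exact: fz.
Qed.

(** The test function is the supremum of the increments over a neighbourhood of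
    [f0], divided by [e] and truncated at [1]. Tightness provides a compact set
    of mass at least [1 - eps / 2], and on its cover by small balls the test
    function is at most [eps / 2], up to a null set. *)
Lemma bridge_equicontinuity_test (f0 : F) (e eps : R) : 0 < e -> 0 < eps ->
  exists2 dl : R, 0 < dl & exists h : linf R F -> R,
  [/\ forall z, 0 <= h z <= 1,
      forall z y, `|h z - h y| <= 2 / e * `|z - y|,
      (\int[L]_z (h z)%:E <= eps%:E)%E &
      forall (z : linf R F) f,
        ('N[P]_2%:E[EFin \o (set_val f \- set_val f0)%R] < dl%:E)%E ->
        e <= `|z f - z f0| -> h z = 1].
Proof.
move=> e0 eps0; have e20 : 0 < eps / 2 by rewrite divr_gt0.
have [tL _ _] := PL; have [K cK LK] := tL _ e20.
pose r := e * (eps / 2) / 5.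
have r0 : 0 < r by rewrite divr_gt0 ?mulr_gt0.
have [D' _ KD'] : finite_subset_cover setT (fun z : linf R F => ball z r) K.
  move: (cK); rewrite compact_cover; apply.
    by move=> z _; exact: ball_open.
  by move=> z Kz; exists z => //; exact: ballxx.
have [dl dl0 [Z [mZ Z0 sZ]]] := bridge_balls_equicontinuous f0 (finmap.enum_fset D') r0.
exists dl => //.
pose A := [set f : F | ('N[P]_2%:E[EFin \o (set_val f \- set_val f0)%R] < dl%:E)%E].
pose h z := Num.min 1 (`|oscillation_at A f0 z| / e).
have h01 z : 0 <= h z <= 1.
  by rewrite le_min ler01 divr_ge0 ?(ltW e0)//= ge_min lexx.
have hl z y : `|h z - h y| <= 2 / e * `|z - y|.
  have : `| `|oscillation_at A f0 z| / e - `|oscillation_at A f0 y| / e | <= 2 / e * `|z - y|.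
    rewrite -mulrBl normrM (@ger0_norm _ e^-1) ?invr_ge0 ?(ltW e0)//.
    by rewrite mulrAC ler_wpM2r ?invr_ge0 ?(ltW e0)// oscillation_lipschitz.
  rewrite /h !minEle; set u := _ / e; set v := _ / e; set w := 2 / e * _.
  by do 2 case: ifPn => ?; rewrite ?ler_norml; lra.
exists h; split => //.
  have hd : hausdorff_space (linf R F) by exact: (@norm_hausdorff R (linf R F)).
  have mK := closed_measurable_linf (compact_closed hd cK).
  have mh := continuous_measurable_linf (linf_lipschitz_continuous hl).
  pose B : set (borel_linf R F) := ~` K `|` Z.
  have mB : measurable B by apply: measurableU => //; exact: measurableC.
  apply: (@le_trans _ _ (\int[L]_z ((eps / 2)%:E + (\1_B z)%:E))%E).
    apply: ge0_le_integral => //.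
    - by move=> z _; rewrite lee_fin; case/andP: (h01 z).
    - exact/measurable_EFinP.
    - by apply/measurable_EFinP/measurable_funD.
    - move=> z _; rewrite -EFinD lee_fin indicE.
      have [_|/negP nB] := boolP (z \in B).
        by rewrite (le_trans (andP (h01 z)).2)// lerDr ltW.
      have Kz : K z by apply: contrapT => nKz; apply: nB; rewrite inE; left.
      have [z0 z0D Bz] := KD' _ Kz.
      have [Zz|fz] := sZ _ _ z0D Bz; first by exfalso; apply: nB; rewrite inE; right.
      rewrite addr0 ge_min; apply/orP; right; rewrite ler_pdivrMr//.
      have -> : eps / 2 * e = 5 * r by rewrite /r; field.
      by apply: oscillation_le => //; rewrite mulr_ge0 ?(ltW r0).
  rewrite ge0_integralD//; last 2 first.
  - by move=> z _; rewrite lee_fin ltW.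
  - exact/measurable_EFinP.
  rewrite integral_cst// [X in (_ * X + _)%E]probability_setT mule1 integral_indic// setIT.
  rewrite [leRHS](_ : _ = ((eps / 2)%:E + (eps / 2)%:E)%E); last first.
    by rewrite -EFinD -splitr.
  rewrite leeD2lE// measureU0//; last exact: measurableC.
  rewrite [leLHS](probability_setC _ mK).
  by rewrite leeBlDr ?fin_num_measure// -leeBlDl// -EFinB.
move=> z f fdl ez; rewrite /h min_l// ler_pdivlMr// mul1r.
by apply: (le_trans ez); exact: (@oscillation_ge _ _ A f0 z f fdl).
Qed.

End bridge_test.

(** * Weak convergence of empirical processes *)

Section test_functions.
Local Open Scope ereal_scope.
Context (R : realType).
Notation N := (@normal_prob R 0 1).

Lemma cvge_finP (u : nat -> \bar R) (l : R) : u @ \oo --> l%:E <->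
  forall e : R, (0 < e)%R ->
    \forall n \near \oo, (l - e)%:E <= u n <= (l + e)%:E.
Proof.
split=> [ul e e0|ul].
  move/fine_cvgP : ul => [uf /cvgrPdist_le/(_ _ e0)].
  apply: filterS2 uf => n uf ule; rewrite -(fineK uf) !lee_fin.
  by move: ule; rewrite /= distrC ler_distl.
have uf : \forall n \near \oo, u n \is a fin_num.
  apply: filterS (ul _ ltr01) => n /andP[]; case: (u n) => //.
apply/fine_cvgP; split => //; apply/cvgrPdist_le => e e0.
apply: filterS2 uf (ul _ e0) => n uf.
by rewrite -(fineK uf) !lee_fin /= distrC ler_distl.
Qed.

Lemma bounded_fun01 (T : Type) (h : T -> R) : (forall z, 0 <= h z <= 1)%R -> bounded_fun h.
Proof.
move=> h01; exists 1%R; split; first exact: num_real.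
move=> x x1 z _ /=; have /andP[hz0 hz1] := h01 z.
by rewrite ger0_norm// (le_trans hz1)// ltW.
Qed.

Context d (X : measurableType d) (P : probability X R).
Context (F : set (X -> R)) (mF : forall f, F f -> measurable_fun setT f).
Context (L : probability (borel_linf R F) R) (PL : brownian_bridge P L).

Lemma linf_eval_continuous (f : F) : continuous (fun z : linf R F => z f).
Proof.
apply: (@linf_lipschitz_continuous _ _ _ 1) => z y.
by rewrite mul1r linf_eval_le.
Qed.

(** Both sides integrate [g] against the law of a normal variable: image
    measures turn the equality of laws into an equality of integrals. *)
Lemma bridge_integral (f : F) (g : R -> R) :
  measurable_fun [set: R] g -> (forall t, 0 <= g t)%R ->
  \int[L]_z (g (z f))%:E =
  \int[N]_t (g (Num.sqrt (covariance_under P (set_val f) (set_val f)) * t))%:E.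
Proof.
move=> mg g0; set s := Num.sqrt _.
have mev : @measurable_fun _ _ (borel_linf R F) (measurableTypeR R) setT
    (fun z => (z : linf R F) f).
  exact: continuous_measurable_linf (@linf_eval_continuous f).
have ms : @measurable_fun _ _ (measurableTypeR R) (measurableTypeR R) setT
  (fun t => s * t)%R by exact: measurable_funM.
have mg' : @measurable_fun _ _ (measurableTypeR R) _ setT (EFin \o g).
  exact/measurable_EFinP.
have g0' (D : set R) : {in D, forall y, 0 <= (EFin \o g) y}.
  by move=> y _; rewrite lee_fin.
have HL := @ge0_integral_pushforward _ _ _ _ R _ mev L setT (EFin \o g) measurableT mg' (g0' _).
have HN := @ge0_integral_pushforward _ _ _ _ R _ ms N setT (EFin \o g) measurableT mg' (g0' _).
apply: (etrans (esym HL)); apply: (etrans _ HN).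
apply: eq_measure_integral => A mA _.
exact: (bridge_marginal PL).
Qed.

(** Transfers [bridge_equicontinuity_test] to a process [D] evaluated at a random
    function [phi s]: off the first two sets, [h] takes the value [1] wherever
    the increment is large, so that it dominates the indicator. *)
Lemma increment_outer_prob_le d' (S : measurableType d') (Q : probability S R)
    (G : S -> linf R F) (D : S -> (X -> R) -> R) (phi : S -> X -> R) (f0 : F)
    (e dl : R) (h : linf R F -> R) :
  (forall s, G s = (fun f : F => D s (set_val f)) :> (F -> R)) ->
  (forall z, 0 <= h z <= 1)%R ->
  (forall (z : linf R F) f,
        'N[P]_2%:E[EFin \o (set_val f \- set_val f0)%R] < dl%:E ->
        (e <= `|z f - z f0|)%R -> h z = 1%R) ->
  outer_prob Q [set s | (e <= `|D s (phi s) - D s (set_val f0)|)%R] <=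
  outer_prob Q [set s | ~ F (phi s)] +
  outer_prob Q [set s | dl%:E <= 'N[P]_2%:E[EFin \o (phi s \- set_val f0)%R]] +
  outer_expectation Q (fun s => (h (G s))%:E).
Proof.
move=> GD h01 h1.
apply: (@le_trans _ _ (outer_prob Q ([set s | ~ F (phi s)] `|`
    [set s | dl%:E <= 'N[P]_2%:E[EFin \o (phi s \- set_val f0)%R]] `|`
    [set s | h (G s) = 1%R]))).
  apply: le_outer_prob => s /= es.
  have [Fs|Fs] := pselect (F (phi s)); last by left; left.
  have [Ns|Ns] := leP dl%:E 'N[P]_2%:E[EFin \o (phi s \- set_val f0)%R].
    by left; right.
  right; pose f : F := SigSub (mem_set Fs).
  by apply: (h1 _ f) => //; rewrite GD.
apply: (le_trans (outer_probU _ _ _)); apply: leeD; first exact: outer_probU.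
apply: le_outer_expectation => s; rewrite lee_fin indicE.
have [/set_mem /= ->//|_] := boolP (s \in _).
by case/andP: (h01 (G s)).
Qed.


Lemma integral_test_fin (h : linf R F -> R) (c : R) : continuous h ->
  (forall z, 0 <= h z <= c)%R ->
  \int[L]_z (h z)%:E = (fine (\int[L]_z (h z)%:E))%:E.
Proof.
move=> ch hc; have mh := continuous_measurable_linf ch; rewrite fineK//.
rewrite ge0_fin_numE; last first.
  by apply: integral_ge0 => z _; rewrite lee_fin; case/andP: (hc z).
apply: (@le_lt_trans _ _ (\int[L]_z (cst c%:E) z)).
  apply: ge0_le_integral => //.
  - by move=> z _; rewrite lee_fin; case/andP: (hc z).
  - exact/measurable_EFinP.
  - by move=> z _; rewrite lee_fin; case/andP: (hc z).
by rewrite integral_cst// [X in _ * X]probability_setT mule1 ltry.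
Qed.

(** The expectation of the test function under the processes is eventually at
    most its integral under the bridge plus a small constant. *)
Lemma weak_cvg_increment (dS : nat -> measure_display)
    (S : forall n, measurableType (dS n)) (Q : forall n, probability (S n) R)
    (D : forall n, S n -> (X -> R) -> R) (phi : forall n, S n -> X -> R)
    (f0 : F) (e : R) : (0 < e)%R ->
  weak_cvg Q (fun n s (f : F) => D n s (set_val f)) L ->
  outer_negligible Q (fun n => [set s | ~ F (phi n s)]) ->
  (forall c : R, (0 < c)%R -> outer_negligible Q (fun n =>
    [set s | c%:E <= 'N[P]_2%:E[EFin \o (phi n s \- set_val f0)%R]])) ->
  outer_negligible Q (fun n =>
    [set s | (e <= `|D n s (phi n s) - D n s (set_val f0)|)%R]).
Proof.
move=> e0 [G [GD Gcvg]] /outer_negligibleP FQ NQ; apply/outer_negligibleP => eta eta0.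
have eta4 : (0 < eta / 4)%R by rewrite divr_gt0.
have [dl dl0 [h [h01 hl hint h1]]] := bridge_equicontinuity_test mF PL f0 e0 eta4.
have ch := linf_lipschitz_continuous hl.
have bh : bounded_fun h.
  exact: bounded_fun01.
have := Gcvg h ch bh; rewrite (integral_test_fin ch h01) => /cvge_finP/(_ _ eta4) hcvg.
have /outer_negligibleP NQ' := NQ _ dl0.
near=> n; apply: (le_trans (@increment_outer_prob_le _ _ (Q n) (G n) (D n) (phi n)
  f0 e dl h (GD n) h01 h1)).
rewrite [leRHS](_ : _ = (eta / 4)%:E + (eta / 4)%:E + (eta / 4 + eta / 4)%:E); last first.
  by rewrite -!EFinD; congr EFin; field.
apply: leeD; first apply: leeD.
- by near: n; exact: FQ.
- by near: n; exact: NQ'.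
- have /andP[_ /le_trans] : (fine (\int[L]_z (h z)%:E) - eta / 4)%:E <=
     outer_expectation (Q n) (fun s => (h (G n s))%:E) <=
     (fine (\int[L]_z (h z)%:E) + eta / 4)%:E by near: n.
  apply; rewrite lee_fin lerD2r -lee_fin -(integral_test_fin ch h01)//.
Unshelve. all: by end_near. Qed.

Lemma weak_cvg_marginal (dS : nat -> measure_display)
    (S : forall n, measurableType (dS n)) (Q : forall n, probability (S n) R)
    (D : forall n, S n -> (X -> R) -> R) (f : F) (g : R -> R) :
  weak_cvg Q (fun n s (f : F) => D n s (set_val f)) L ->
  continuous g -> (forall t, 0 <= g t <= 1)%R ->
  outer_expectation (Q n) (fun s => (g (D n s (set_val f)))%:E) @[n --> \oo] -->
  \int[N]_t (g (Num.sqrt (covariance_under P (set_val f) (set_val f)) * t))%:E.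
Proof.
move=> [G [GD Gcvg]] cg g01.
rewrite -bridge_integral//; last 2 first.
- exact: continuous_measurable_fun.
- by move=> t; case/andP: (g01 t).
have := Gcvg (fun z => g (z f)) _ _.
rewrite (_ : (fun n => outer_expectation (Q n) (fun s => (g (G n s f))%:E)) =
    (fun n => outer_expectation (Q n) (fun s => (g (D n s (set_val f)))%:E))); last first.
  by apply/funext => n; congr outer_expectation; apply/funext => s; rewrite GD.
apply.
- move=> z; apply: (@continuous_comp _ _ _ (fun z : linf R F => z f) g).
    exact: linf_eval_continuous.
  exact: cg.
- by apply: bounded_fun01 => z.
Qed.

End test_functions.

(** * Conditional convergence *)

Section conditional.
Local Open Scope ereal_scope.
Context (R : realType) dX (X : measurableType dX) (P0 : probability X R)
  (dW : nat -> measure_display) (W : forall n, measurableType (dW n))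
  (Q : forall n, probability (W n) R).
Notation N := (@normal_prob R 0 1).

Definition cond_negligible (A : forall n, n.-tuple X -> set (n.-tuple (W n))) :=
  forall e : R, (0 < e)%R ->
    outer_negligible (iid_law P0) (fun n => [set x | e%:E <= PW Q (A n x)]).

Lemma cvg_outer_prob_negligible (A : forall n, n.-tuple X -> set (n.-tuple (W n))) :
  cvg_outer_prob (iid_law P0) (fun n x => PW Q (A n x)) 0 -> cond_negligible A.
Proof.
move=> A0 e e0; apply: outer_negligibleS (A0 _ e0); apply: nearW => n x /= eA.
by rewrite sube0 gee0_abs//; exact: outer_prob_ge0.
Qed.

Lemma cond_negligibleS (A B : forall n, n.-tuple X -> set (n.-tuple (W n))) :
  (forall n x, A n x `<=` B n x) -> cond_negligible B -> cond_negligible A.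
Proof.
move=> AB B0 e e0; apply: outer_negligibleS (B0 _ e0); apply: nearW => n x /= eA.
by apply: (le_trans eA); exact/le_outer_prob/AB.
Qed.

Lemma cond_negligibleU (A B : forall n, n.-tuple X -> set (n.-tuple (W n))) :
  cond_negligible A -> cond_negligible B -> cond_negligible (fun n x => A n x `|` B n x).
Proof.
move=> A0 B0 e e0; have e20 : (0 < e / 2)%R by rewrite divr_gt0.
apply: outer_negligibleS (outer_negligibleU (A0 _ e20) (B0 _ e20)); apply: nearW => n x /= eAB.
have [eA|Ae] := leP (e / 2)%:E (PW Q (A n x)); [by left|right].
rewrite leNgt; apply/negP => Be; move: eAB; rewrite leNgt => /negP; apply.
apply: (le_lt_trans (outer_probU _ _ _)).
by rewrite (splitr e) EFinD; exact: lteD.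
Qed.

Context (F : set (X -> R)) (mF : forall f, F f -> measurable_fun setT f).
Context (L : probability (borel_linf R F) R) (PL : brownian_bridge P0 L).
Context (D : forall n, n.-tuple X -> n.-tuple (W n) -> (X -> R) -> R).
Hypothesis Dcvg : cond_weak_cvg P0 Q (fun n x w (f : F) => D x w (set_val f)) L.

(** Bounded Lipschitz test functions reduce to [BL1] after rescaling. *)
Lemma cond_weak_cvg_test : exists Gl : forall n, n.-tuple X -> n.-tuple (W n) -> linf R F,
  (forall n x w, Gl n x w = (fun f : F => D x w (set_val f)) :> (F -> R)) /\
  forall (h : linf R F -> R) (c : R), (0 < c)%R -> (forall z, 0 <= h z <= c)%R ->
    (forall z y, `|h z - h y| <= c * `|z - y|)%R ->
  forall e : R, (0 < e)%R -> outer_negligible (iid_law P0) (fun n => [set x | e%:E <=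
    `|EW Q (fun w => (h (Gl n x w))%:E) - \int[L]_z (h z)%:E|]).
Proof.
have [Gl [GD Gsup]] := Dcvg; exists Gl; split => // h c c0 hc hl e e0.
have ch := linf_lipschitz_continuous hl.
have mh := continuous_measurable_linf ch.
have ec0 : (0 < e / c)%R by rewrite divr_gt0.
pose h' z : R := (c^-1 * h z)%R.
have h'h z : h z = (c * h' z)%R by rewrite /h' mulVKf// gt_eqF.
have h'01 z : (0 <= h' z <= 1)%R.
  have /andP[h0 h1] := hc z; rewrite /h' mulr_ge0 ?invr_ge0 ?(ltW c0)//=.
  by rewrite mulrC ler_pdivrMr// mul1r.
have h'l z y : (`|h' z - h' y| <= 1 * `|z - y|)%R.
  rewrite /h' -mulrBr normrM gtr0_norm ?invr_gt0// mulrC ler_pdivrMr// mul1r.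
  by rewrite mulrC hl.
have ch' := linf_lipschitz_continuous h'l.
have mh' := continuous_measurable_linf ch'.
have If := integral_test_fin L ch' h'01.
apply: outer_negligibleS (Gsup _ ec0); apply: nearW => n x /= ex.
rewrite sube0; apply: (@le_trans _ _
  (`|EW Q (fun w => (h' (Gl n x w))%:E) - \int[L]_z (h' z)%:E|)).
  have EWE : EW Q (fun w => (h (Gl n x w))%:E) =
      c%:E * EW Q (fun w => (h' (Gl n x w))%:E).
    rewrite /EW -outer_expectation_scale//.
      by congr outer_expectation; apply/funext => w; rewrite h'h EFinM.
    by move=> w; rewrite lee_fin; case/andP: (h'01 (Gl n x w)).
  have IE : \int[L]_z (h z)%:E = c%:E * \int[L]_z (h' z)%:E.
    rewrite -ge0_integralZl_EFin//; last 3 first.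
    - by move=> z _; rewrite lee_fin; case/andP: (h'01 z).
    - exact/measurable_EFinP.
    - exact: ltW.
    by apply: eq_integral => z _; rewrite h'h EFinM.
  move: ex; rewrite EWE IE If -muleBr//; last by rewrite fin_num_adde_defl.
  rewrite abseM gee0_abs ?lee_fin ?(ltW c0)// => ex.
  by rewrite EFinM muleC lee_pdivrMl.
rewrite [leRHS]gee0_abs; last first.
  apply: le_ereal_sup_tmp; exists `|EW Q (fun w => (h' (Gl n x w))%:E) - \int[L]_z (h' z)%:E| => //.
  exists h' => //; split => [z|z y]; last by rewrite -[leRHS]mul1r.
  by have /andP[? ?] := h'01 z; rewrite ger0_norm.
apply: ereal_sup_ubound; exists h' => //; split => [z|z y]; last by rewrite -[leRHS]mul1r.
by have /andP[? ?] := h'01 z; rewrite ger0_norm.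
Qed.

(** Conditional counterpart of [weak_cvg_increment]: the conditional
    expectation of the test function is now close to its integral with outer
    probability tending to one. *)
Lemma cond_weak_cvg_increment (phi : forall n, n.-tuple X -> n.-tuple (W n) -> X -> R)
    (f0 : F) (e : R) : (0 < e)%R ->
  cond_negligible (fun n x => [set w | ~ F (phi n x w)]) ->
  (forall c : R, (0 < c)%R -> cond_negligible (fun n x =>
    [set w | c%:E <= 'N[P0]_2%:E[EFin \o (phi n x w \- set_val f0)%R]])) ->
  cond_negligible (fun n x =>
    [set w | (e <= `|D x w (phi n x w) - D x w (set_val f0)|)%R]).
Proof.
move=> e0 FQ NQ eta eta0.
have eta4 : (0 < eta / 4)%R by rewrite divr_gt0.
have [Gl [GD test]] := cond_weak_cvg_test.
have [dl dl0 [h [h01 hl hint h1]]] := bridge_equicontinuity_test mF PL f0 e0 eta4.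
have If := integral_test_fin L (linf_lipschitz_continuous hl) h01.
pose c : R := (1 + 2 / e)%R.
have e2 : (0 <= 2 / e)%R by rewrite divr_ge0// ltW.
have c0 : (0 < c)%R by rewrite /c; lra.
have hc z : (0 <= h z <= c)%R.
  by have /andP[-> hz] := h01 z; rewrite (le_trans hz)// /c lerDl.
have hcl z y : (`|h z - h y| <= c * `|z - y|)%R.
  by apply: (le_trans (hl _ _)); rewrite ler_wpM2r// /c lerDr.
have A3 := test h c c0 hc hcl _ eta4.
apply: outer_negligibleS (outer_negligibleU (outer_negligibleU (FQ _ eta4) (NQ _ dl0 _ eta4)) A3).
apply: nearW => n x /= ex.
have [pF|Fp] := leP (eta / 4)%:E (PW Q [set w | ~ F (phi n x w)]); first by left; left.
have [pN|Np] := leP (eta / 4)%:E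
  (PW Q [set w | dl%:E <= 'N[P0]_2%:E[EFin \o (phi n x w \- set_val f0)%R]]).
  by left; right.
right; rewrite leNgt; apply/negP => hE; move: ex; rewrite leNgt => /negP; apply.
apply: le_lt_trans (@increment_outer_prob_le _ _ _ P0 F _ _ (iid_law (Q n) n)
  (Gl n x) (D x) (phi n x) f0 e dl h (GD n x) h01 h1) _.
have Eh : outer_expectation (iid_law (Q n) n) (fun w => (h (Gl n x w))%:E) < (eta / 2)%:E.
  have E0 : 0 <= EW Q (fun w => (h (Gl n x w))%:E).
    by apply: outer_expectation_ge0 => w; rewrite lee_fin; case/andP: (h01 (Gl n x w)).
  move: hE hint E0; rewrite If -/(EW Q _); case: (EW Q _) => [u| |//].
    rewrite -EFinB /= !lee_fin !lte_fin ltr_norml => /andP[? ?] ? ?; lra.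
  by rewrite /= ltNge leey.
have -> : eta%:E = (eta / 4)%:E + (eta / 4)%:E + (eta / 2)%:E.
  by rewrite -!EFinD; congr EFin; field.
by apply: lteD => //; exact: lteD.
Qed.

(** Evaluation at [f] is a contraction, so a truncated square of the value at
    [f] is a bounded Lipschitz test function of the path. *)
Lemma cond_trunc_moment_cvg (f : F) (m e : R) : (0 < m)%R -> (0 < e)%R ->
  outer_negligible (iid_law P0) (fun n => [set x | e%:E <=
    `|EW Q (fun w => (sqtrunc m (D x w (set_val f)))%:E) -
      \int[N]_t (sqtrunc m
        (Num.sqrt (covariance_under P0 (set_val f) (set_val f)) * t))%:E|]).
Proof.
move=> m0 e0; have [Gl [GD test]] := cond_weak_cvg_test.
have sm0 := sqrtr_ge0 m.
pose c := (m + 2 * Num.sqrt m)%R.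
have c0 : (0 < c)%R by rewrite /c; lra.
have hc (z : linf R F) : (0 <= sqtrunc m (z f) <= c)%R.
  rewrite sqtrunc_ge0 (le_trans (sqtrunc_le _ (ltW m0)))// /c lerDl.
  by rewrite mulr_ge0.
have hcl (z y : linf R F) : (`|sqtrunc m (z f) - sqtrunc m (y f)| <= c * `|z - y|)%R.
  apply: (le_trans (sqtrunc_lipschitz _ _ (ltW m0))).
  apply: ler_pM; rewrite ?mulr_ge0 ?linf_eval_le//.
  by rewrite /c lerDr ltW.
apply: outer_negligibleS (test _ c c0 hc hcl _ e0); apply: nearW => n x /=.
rewrite (bridge_integral PL f (measurable_sqtrunc m) (sqtrunc_ge0 m)).
rewrite (_ : (fun w => (sqtrunc m (Gl n x w f))%:E) =
  (fun w => (sqtrunc m (D x w (set_val f)))%:E))//.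
by apply/funext => w; rewrite GD.
Qed.

End conditional.

(** * Bootstrap second moment *)

Section second_moment.
Local Open Scope ereal_scope.
Context (R : realType).
Notation N := (@normal_prob R 0 1).

Lemma limn_esup_lt (u : nat -> \bar R) (l : \bar R) :
  limn_esup u < l -> \forall n \near \oo, u n < l.
Proof.
rewrite limn_esup_lim (cvg_lim _ (@cvg_esups_inf _ u))//.
move=> /ereal_inf_lt[_ [m _ <-] ul]; exists m => // n /= mn.
by apply: le_lt_trans ul; apply: ereal_sup_ubound; exists n.
Qed.

Lemma limn_esup_cvg0 (u : nat -> nat -> \bar R) (e : R) : (0 < e)%R ->
  (fun m => limn_esup (u m)) @ \oo --> 0 ->
  \forall m \near \oo, \forall n \near \oo, u m n <= e%:E.
Proof.
move=> e0 /cvge_finP ul; have e20 : (0 < e / 2)%R by rewrite divr_gt0.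
apply: filterS (ul _ e20) => m /andP[_]; rewrite add0r => ue.
have : limn_esup (u m) < e%:E.
  by apply: (le_lt_trans ue); rewrite lte_fin ltr_pdivrMr// ltr_pMr// ltr1n.
by move=> /limn_esup_lt; apply: filterS => n /ltW.
Qed.

(** The decomposition [t^2 <= g + t^2 1_(m <= t^2)] for the bounded Lipschitz
    truncation [g] of the square at level [m]. *)
Lemma second_moment_sandwich d (S : measurableType d) (Q : probability S R)
    (T V : S -> R) (m e : R) : (0 < m)%R -> (0 < e)%R ->
  let A := [set w | (e <= `|T w - V w|)%R] in
  let k := (2 * Num.sqrt m * e)%R in
  outer_expectation Q (fun w => (T w ^+ 2)%:E) <=
    outer_expectation Q (fun w => (sqtrunc m (V w))%:E) + k%:E +
    m%:E * outer_prob Q A +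
    outer_expectation Q
      (fun w => (T w ^+ 2 * \1_[set t : R | (m <= t)%R] (T w ^+ 2))%:E) /\
  outer_expectation Q (fun w => (sqtrunc m (V w))%:E) <=
    outer_expectation Q (fun w => (T w ^+ 2)%:E) + k%:E +
    m%:E * outer_prob Q A.
Proof.
move=> m0 e0 A k.
have k0 : (0 <= k)%R by rewrite !mulr_ge0 ?sqrtr_ge0// ltW.
have trunc_le (U U' : S -> R) : (forall w, `|U w - U' w| = `|T w - V w|)%R ->
    forall w, (sqtrunc m (U w) <= sqtrunc m (U' w) + k + m * \1_A w)%R.
  move=> UU w; rewrite indicE.
  have [/set_mem /= Aw|/negP Aw] := boolP (w \in A).
    rewrite mulr1 (le_trans (sqtrunc_le _ (ltW m0)))// lerDr.
    by rewrite addr_ge0// sqtrunc_ge0.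
  rewrite mulr0 addr0 -lerBlDl (le_trans (ler_norm _))//.
  rewrite (le_trans (sqtrunc_lipschitz _ _ (ltW m0)))// UU.
  rewrite /k ler_wpM2l ?mulr_ge0 ?sqrtr_ge0// leNgt; apply/negP => /ltW eT.
  by apply: Aw; rewrite inE.
have E3 (f : S -> R) : (forall w, 0 <= f w)%R ->
    outer_expectation Q (fun w => (f w + k + m * \1_A w)%:E) <=
    outer_expectation Q (fun w => (f w)%:E) + k%:E + m%:E * outer_prob Q A.
  move=> f0; have -> : (fun w => (f w + k + m * \1_A w)%:E) =
      ((fun w => (f w)%:E) \+ cst k%:E) \+ (fun w => m%:E * (\1_A w)%:E).
    by apply/funext.
  apply: le_trans (outer_expectationD _ _ _) _ => [w|w|].
  - by rewrite /= -EFinD lee_fin addr_ge0.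
  - by rewrite mule_ge0// lee_fin// ltW.
  rewrite outer_expectation_scale//.
  apply: leeD => //; apply: le_trans (outer_expectationD _ _ _) _ => [w|w|].
  - by rewrite lee_fin.
  - by rewrite lee_fin.
  by rewrite outer_expectation_cst.
split.
  apply: (@le_trans _ _ (outer_expectation Q
    ((fun w => (sqtrunc m (V w) + k + m * \1_A w)%:E) \+
     (fun w => (T w ^+ 2 * \1_[set t : R | (m <= t)%R] (T w ^+ 2))%:E)))).
    apply: le_outer_expectation => w; rewrite -EFinD lee_fin.
    apply: le_trans (lerD (trunc_le T V (fun=> erefl) w) (lexx _)).
    rewrite indicE; have [_|/negP mT] := boolP (_ \in _).
      by rewrite mulr1 lerDr sqtrunc_ge0.
    rewrite mulr0 addr0 sqtrunc_eq// leNgt; apply/negP => /ltW Tm.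
    by apply: mT; rewrite inE.
  apply: le_trans (outer_expectationD _ _ _) _ => [w|w|].
  - by rewrite lee_fin !addr_ge0 ?sqtrunc_ge0// mulr_ge0// ltW.
  - by rewrite lee_fin mulr_ge0// sqr_ge0.
  by apply: leeD => //; apply: E3 => w; exact: sqtrunc_ge0.
apply: le_trans (E3 (fun w => T w ^+ 2)%R _) => [|w]; last exact: sqr_ge0.
apply: le_outer_expectation => w; rewrite lee_fin.
apply: (le_trans (trunc_le V T _ w)); first by move=> ?; rewrite distrC.
by rewrite -!addrA lerD2r sqtrunc_le_sqr.
Qed.

Lemma sandwich_dist (a b p u : \bar R) (J s e k m : R) :
  0 <= a -> 0 <= b -> 0 <= p -> 0 <= u -> (0 < e)%R -> (k <= e / 5)%R ->
  (0 < m)%R ->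
  a <= b + k%:E + m%:E * p + u -> b <= a + k%:E + m%:E * p ->
  `|b - J%:E| < (e / 5)%:E -> p < (e / 5 / m)%:E -> u < (e / 5)%:E ->
  (`|J - s| <= e / 5)%R -> `|a - s%:E| < e%:E.
Proof.
move=> a0 b0 p0 u0 e0 ke m0 ab ba bJ pe ue Js.
case: b b0 bJ ab ba => [b| |//] b0 bJ; last by rewrite /= ltNge leey in bJ.
case: p p0 pe => [p| |//] p0 pe; last by rewrite ltNge leey in pe.
case: u u0 ue => [u| |//] u0 ue; last by rewrite ltNge leey in ue.
case: a a0 => [a| |//] a0; last by rewrite leNgt ltry.
move: a0 b0 p0 u0 bJ pe ue.
rewrite -!EFinM -?EFinB -!EFinD /= !lee_fin !lte_fin => a0 b0 p0 u0 bJ.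
rewrite ltr_pdivlMr// (mulrC p) => pe ue ab ba.
move: bJ Js; rewrite !ltr_norml !ler_norml => /andP[? ?] /andP[? ?].
by apply/andP; split; lra.
Qed.

End second_moment.

Section bootstrap_variance.
Local Open Scope ereal_scope.
Context (R : realType) dX (X : measurableType dX) (P0 : probability X R)
  (dW : nat -> measure_display) (W : forall n, measurableType (dW n))
  (Q : forall n, probability (W n) R).
Notation N := (@normal_prob R 0 1).

(** The truncation level [m] is fixed first, large enough for the bias of the
    truncated normal moment and for the uniform integrability; the remainder
    term is then controlled by Markov's inequality, and the truncated moment by
    the two convergence hypotheses. *)
Lemma cond_second_moment_cvg
    (T V : forall n, n.-tuple X -> n.-tuple (W n) -> R) (s : R) :
  (forall e : R, (0 < e)%R ->
    cond_negligible P0 Q (fun n x => [set w | (e <= `|T n x w - V n x w|)%R])) ->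
  (forall m e : R, (0 < m)%R -> (0 < e)%R ->
    outer_negligible (iid_law P0) (fun n => [set x | e%:E <=
    `|EW Q (fun w => (sqtrunc m (V n x w))%:E) -
      \int[N]_t (sqtrunc m (s * t))%:E|])) ->
  (fun m : nat => limn_esup (fun n => outer_expectation (iid_law P0 n)
    (fun x => EW Q (fun w =>
      (T n x w ^+ 2 * \1_[set t : R | (m%:R <= t)%R] (T n x w ^+ 2))%:E))))
    @ \oo --> 0 ->
  forall e : R, (0 < e)%R -> outer_negligible (iid_law P0) (fun n =>
    [set x | e%:E <= `|EW Q (fun w => (T n x w ^+ 2)%:E) - (s ^+ 2)%:E|]).
Proof.
move=> TV Vm UI e e0; apply/outer_negligibleP => eta eta0.
have e5 : (0 < e / 5)%R by rewrite divr_gt0.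
have eta4 : (0 < eta / 4)%R by rewrite divr_gt0.
have dl0 : (0 < e / 5 * (eta / 2))%R by rewrite mulr_gt0// divr_gt0.
have U1 := limn_esup_cvg0 dl0 UI.
have /cvge_finP/(_ _ e5) U2 := @std_normal_trunc_moment_cvg R s.
have U3 : \forall m \near \oo, (0 < m)%N by exact: nbhs_infty_gt.
have [m [[UIm Jm] m0]] : exists m : nat,
   ((\forall n \near \oo, outer_expectation (iid_law P0 n)
    (fun x => EW Q (fun w =>
      (T n x w ^+ 2 * \1_[set t : R | (m%:R <= t)%R] (T n x w ^+ 2))%:E)) <=
      (e / 5 * (eta / 2))%:E) /\
   (s ^+ 2 - e / 5)%:E <= \int[N]_t (sqtrunc m%:R (s * t))%:E <=
        (s ^+ 2 + e / 5)%:E) /\ (0 < m)%N.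
  by have [m mP] := filter_ex (filterI (filterI U1 U2) U3); exists m.
have mR : (0 < m%:R :> R)%R by rewrite ltr0n.
set I := \int[N]_t _ in Jm.
have IE : I = (fine I)%:E.
  by move: Jm => /andP[]; case: I.
pose k : R := (2 * Num.sqrt m%:R + 1)%R.
have k0 : (0 < k)%R by rewrite /k ltr_wpDl// mulr_ge0// sqrtr_ge0.
pose e1 : R := (e / 5 / k)%R.
have e10 : (0 < e1)%R by rewrite divr_gt0.
have e5m : (0 < e / 5 / m%:R)%R by rewrite divr_gt0.
have /outer_negligibleP/(_ _ eta4) B1 := Vm _ _ mR e5.
have /outer_negligibleP/(_ _ eta4) B2 := TV _ e10 _ e5m.
apply: filterS2 (filterI B1 B2) UIm => n [{}B1 {}B2] {}UIm.
pose u x := EW Q (fun w =>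
      (T n x w ^+ 2 * \1_[set t : R | (m%:R <= t)%R] (T n x w ^+ 2))%:E).
have u0 x : 0 <= u x.
  by apply: outer_expectation_ge0 => w; rewrite lee_fin mulr_ge0// sqr_ge0.
have B3 : outer_prob (iid_law P0 n) [set x | (e / 5)%:E <= u x] <= (eta / 2)%:E.
  apply: le_trans (outer_markov _ e5 u0) _.
  rewrite muleC -lee_pdivlMr ?invr_gt0// invrK -EFinM mulrC.
  exact: UIm.
have -> : eta%:E = (eta / 4)%:E + (eta / 4)%:E + (eta / 2)%:E.
  by rewrite -!EFinD; congr EFin; field.
apply: le_trans (leeD (leeD B1 B2) B3).
apply: le_trans (leeD (outer_probU _ _ _) (lexx _)).
apply: le_trans (outer_probU _ _ _).
apply: le_outer_prob => x /= ex.
have [b1|b1] := leP (e / 5)%:E `|EW Q (fun w => (sqtrunc m%:R (V n x w))%:E) - I|.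
  by left; left.
have [b2|b2] := leP (e / 5 / m%:R)%:E
  (PW Q [set w | (e1 <= `|T n x w - V n x w|)%R]); first by left; right.
have [b3|b3] := leP (e / 5)%:E (u x); first by right.
exfalso; move: ex; rewrite leNgt => /negP; apply.
have [ab ba] := second_moment_sandwich (iid_law (Q n) n) (T n x) (V n x) mR e10.
rewrite IE in b1.
apply: (@sandwich_dist R (EW Q (fun w => (T n x w ^+ 2)%:E)) _ _ _
  (fine I) (s ^+ 2) e _ _ _ _ _ _ e0 _ mR ab ba b1 b2 b3).
- by apply: outer_expectation_ge0 => w; rewrite lee_fin sqr_ge0.
- by apply: outer_expectation_ge0 => w; rewrite lee_fin sqtrunc_ge0.
- exact: outer_prob_ge0.
- exact: u0.
- rewrite /e1 mulrCA ler_piMr ?(ltW e5)// ler_pdivrMr// mul1r /k lerDl//.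
- by move: Jm; rewrite IE !lee_fin ler_distl.
Qed.

(** For nonnegative numbers, the squared distance of the square roots is at
    most the distance of the numbers. *)
Lemma sqrt_cvg_outer_prob (dS : nat -> measure_display)
    (S : forall n, measurableType (dS n)) (P : forall n, probability (S n) R)
    (Y : forall n, S n -> \bar R) (s : R) : (0 <= s)%R ->
  (forall n x, 0 <= Y n x) ->
  (forall e : R, (0 < e)%R ->
    outer_negligible P (fun n => [set x | e%:E <= `|Y n x - (s ^+ 2)%:E|])) ->
  cvg_outer_prob P (fun n x => Y n x `^ 2^-1) s.
Proof.
move=> s0 Y0 Ys e e0.
have e20 : (0 < e ^+ 2)%R by rewrite exprn_gt0.
apply: outer_negligibleS (Ys _ e20); apply: nearW => n x /=; have := Y0 n x.
case: (Y n x) => [r| |//]; last by move=> _ _; rewrite /= leey.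
rewrite lee_fin => r0; rewrite poweR_EFin powR12_sqrt// -!EFinB /= !lee_fin => er.
rewrite -{1}(sqr_sqrtr r0) subr_sqr normrM expr2.
have rs : (0 <= Num.sqrt r + s)%R by rewrite addr_ge0 ?sqrtr_ge0.
rewrite (ger0_norm rs) ler_pM ?(ltW e0)// (le_trans er)//.
have := sqrtr_ge0 r; rewrite ler_norml => r1.
by apply/andP; split; lra.
Qed.

End bootstrap_variance.

(** * Coverage of a studentized interval *)

Section coverage.
Local Open Scope ereal_scope.
Context (R : realType).
Notation N := (@normal_prob R 0 1).
Notation pk := (@normal_peak R 1).

(** A continuous function between the indicators of [[c, d]] and of its
    [dl]-neighbourhood. *)
Definition trapezoid (c d dl t : R) : R :=
  Num.max 0%R (Num.min 1%R (Num.min ((t - c) / dl) ((d - t) / dl) + 1))%R.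

Lemma trapezoid01 c d dl t : (0 <= trapezoid c d dl t <= 1)%R.
Proof.
rewrite /trapezoid le_max lexx/= ge_max ler01/= ge_min lexx//.
Qed.

Lemma continuous_trapezoid c d dl : continuous (trapezoid c d dl).
Proof.
have cmin (f g : R -> R) : continuous f -> continuous g ->
    continuous (fun t => Num.min (f t) (g t)).
  by move=> cf cg t; exact: (@continuous_min R R f g t (cf t) (cg t)).
have cmax (f g : R -> R) : continuous f -> continuous g ->
    continuous (fun t => Num.max (f t) (g t)).
  by move=> cf cg t; exact: (@continuous_max R R f g t (cf t) (cg t)).
apply: (cmax _ _); first by move=> t; exact: cvg_cst.
apply: (cmin _ _); first by move=> t; exact: cvg_cst.
move=> t; apply: cvgD; last exact: cvg_cst.
apply: (cmin (fun t => (t - c) / dl)%R (fun t => (d - t) / dl)%R) => {}t;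
  apply: cvgM; try exact: cvg_cst.
- by apply: cvgB; [exact: cvg_id|exact: cvg_cst].
- by apply: cvgB; [exact: cvg_cst|exact: cvg_id].
Qed.

Lemma trapezoid_eq1 c d dl t : (0 < dl)%R -> (c <= t <= d)%R -> trapezoid c d dl t = 1%R.
Proof.
move=> dl0 /andP[ct td]; rewrite /trapezoid min_l ?max_r//.
by rewrite lerDr le_min !divr_ge0 ?subr_ge0// ltW.
Qed.

Lemma trapezoid_eq0 c d dl t : (0 < dl)%R -> ~~ (c - dl <= t <= d + dl)%R ->
  trapezoid c d dl t = 0%R.
Proof.
move=> dl0; rewrite negb_and -!ltNge => ctd; rewrite /trapezoid max_l// ge_min.
apply/orP; right; rewrite -lerBrDr sub0r ge_min !ler_pdivrMr// !mulN1r.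
by apply/orP; case/orP: ctd => ?; [left|right]; lra.
Qed.

Lemma trapezoid_le_indic c d dl t : (0 < dl)%R ->
  (trapezoid c d dl t <= \1_`[(c - dl)%R, (d + dl)%R] t)%R.
Proof.
move=> dl0; rewrite indicE; have [_|] := boolP (t \in _).
  by case/andP: (trapezoid01 c d dl t).
move=> /negP tI; rewrite trapezoid_eq0//; apply/negP => ctd; apply: tI.
by rewrite inE /= in_itv.
Qed.

Lemma indic_le_trapezoid c d dl t : (0 < dl)%R ->
  (\1_`[c, d] t <= trapezoid c d dl t)%R.
Proof.
move=> dl0; rewrite indicE; have [|_] := boolP (t \in _).
  by rewrite inE /= in_itv/= => ctd; rewrite trapezoid_eq1.
by case/andP: (trapezoid01 c d dl t).
Qed.

Lemma std_normal_itv_widen c d dl : (0 < dl)%R ->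
  N `[(c - dl)%R, (d + dl)%R]%classic <= N `[c, d]%classic + (2 * pk * dl)%:E.
Proof.
move=> dl0.
have cdl : (c - dl <= c)%R by lra.
have ddl : (d <= d + dl)%R by lra.
apply: (@le_trans _ _ (N (`[c, d] `|` (`[(c - dl)%R, c] `|` `[d, (d + dl)%R]))%classic)).
  apply: le_measure; rewrite ?inE//; first by do 2 apply: measurableU => //.
  move=> t /=; rewrite !in_itv/= => /andP[ct td].
  have [tc|tc] := leP t c; first by right; left; rewrite ct.
  have [dt|dt] := leP d t; first by right; right.
  by left; rewrite (ltW tc) (ltW dt).
apply: le_trans (measureU2 _ _ _) _ => //; first exact: measurableU.
apply: leeD => //; apply: le_trans (measureU2 _ _ _) _ => //.
apply: le_trans (leeD (std_normal_itv_le cdl) (std_normal_itv_le ddl)) _.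
by rewrite -EFinD lee_fin; have := @normal_peak_ge0 R 1; set p := normal_peak 1; nra.
Qed.

Lemma integral_trapezoid_le c d dl : (0 < dl)%R ->
  \int[N]_t (trapezoid c d dl t)%:E <= N `[(c - dl)%R, (d + dl)%R]%classic.
Proof.
move=> dl0; have mt : measurable_fun [set: R] (trapezoid c d dl).
  by apply: continuous_measurable_fun; exact: continuous_trapezoid.
have -> : N `[(c - dl)%R, (d + dl)%R]%classic =
    \int[N]_t (\1_`[(c - dl)%R, (d + dl)%R] t)%:E by rewrite integral_indic// setIT.
apply: ge0_le_integral => //.
- by move=> t _; rewrite lee_fin; case/andP: (trapezoid01 c d dl t).
- exact/measurable_EFinP.
- by apply/measurable_EFinP; exact: measurable_indic.
- by move=> t _; rewrite lee_fin trapezoid_le_indic.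
Qed.

Lemma integral_trapezoid_ge c d dl : (0 < dl)%R ->
  N `[c, d]%classic <= \int[N]_t (trapezoid c d dl t)%:E.
Proof.
move=> dl0; have mt : measurable_fun [set: R] (trapezoid c d dl).
  by apply: continuous_measurable_fun; exact: continuous_trapezoid.
have -> : N `[c, d]%classic = \int[N]_t (\1_`[c, d] t)%:E.
  by rewrite integral_indic// setIT.
apply: ge0_le_integral => //.
- by apply/measurable_EFinP; exact: measurable_indic.
- exact/measurable_EFinP.
- by move=> t _; rewrite lee_fin indic_le_trapezoid.
Qed.

Context (d : nat -> measure_display) (S : forall n, measurableType (d n))
  (P : forall n, probability (S n) R).
Variables (Y : forall n, S n -> R) (s0 : R).
Hypothesis s0_gt0 : (0 < s0)%R.
Hypothesis Ycvg : forall g : R -> R, continuous g -> (forall t, 0 <= g t <= 1)%R ->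
  outer_expectation (P n) (fun s => (g (Y s))%:E) @[n --> \oo] -->
  \int[N]_t (g (s0 * t))%:E.

Lemma trapezoid_cvg c e dl : (0 < dl)%R ->
  outer_expectation (P n) (fun s => (trapezoid c e dl (Y s / s0))%:E) @[n --> \oo] -->
  \int[N]_t (trapezoid c e dl t)%:E.
Proof.
move=> dl0; have := Ycvg (g := fun y => trapezoid c e dl (y / s0)).
rewrite (_ : (fun t => (trapezoid c e dl (s0 * t / s0))%:E) = (fun t => (trapezoid c e dl t)%:E)).
  apply; last by move=> t; exact: trapezoid01.
  move=> t; apply: (@continuous_comp R R R (fun y : R => y / s0)%R (trapezoid c e dl)).
    by apply: cvgM; [exact: cvg_id|exact: cvg_cst].
  exact: continuous_trapezoid.
by apply/funext => t; rewrite mulrAC divff ?mul1r// gt_eqF.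
Qed.

(** The indicator of the interval lies between two trapezoids whose normal
    integrals differ by a multiple of their width. *)
Lemma itv_outer_prob_cvg c e :
  outer_prob (P n) [set s | (c <= Y s / s0 <= e)%R] @[n --> \oo] -->
  N `[c, e]%classic.
Proof.
set p := fine (N `[c, e]%classic).
have pE : N `[c, e]%classic = p%:E by rewrite fineK// fin_num_measure.
rewrite pE; apply/cvge_finP => eps eps0.
have pk0 : (0 < pk)%R by rewrite normal_peak_gt0// oner_neq0.
pose dl : R := (eps / (4 * pk))%R.
have dl0 : (0 < dl)%R by rewrite divr_gt0// mulr_gt0.
have dlE : (2 * pk * dl = eps / 2)%R by rewrite /dl; field; rewrite gt_eqF.
have e20 : (0 < eps / 2)%R by rewrite divr_gt0.
have fin c' e' : \int[N]_t (trapezoid c' e' dl t)%:E \is a fin_num.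
  rewrite ge0_fin_numE; last first.
    by apply: integral_ge0 => t _; rewrite lee_fin; case/andP: (trapezoid01 c' e' dl t).
  apply: le_lt_trans (integral_trapezoid_le _ _ dl0) _.
  by apply: le_lt_trans (probability_le1 _ _) (ltry _).
have := @trapezoid_cvg c e dl dl0; rewrite -(fineK (fin _ _)) => /cvge_finP/(_ _ e20) up.
have := @trapezoid_cvg (c + dl) (e - dl) dl dl0.
rewrite -(fineK (fin _ _)) => /cvge_finP/(_ _ e20) lo.
have upI : (fine (\int[N]_t (trapezoid c e dl t)%:E) <= p + eps / 2)%R.
  rewrite -lee_fin fineK// (le_trans (integral_trapezoid_le _ _ dl0))//.
  by rewrite EFinD -pE -dlE; exact: std_normal_itv_widen.
have loI : (p - eps / 2 <= fine (\int[N]_t (trapezoid (c + dl)%R (e - dl)%R dl t)%:E))%R.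
  rewrite -lee_fin fineK// (le_trans _ (integral_trapezoid_ge _ _ dl0))//.
  rewrite EFinB -pE leeBlDr//; have := @std_normal_itv_widen (c + dl)%R (e - dl)%R dl dl0.
  by rewrite addrK subrK dlE.
apply: filterS2 up lo => n /andP[_ up] /andP[lo _]; apply/andP; split.
  apply: (@le_trans _ _ (outer_expectation (P n)
      (fun s => (trapezoid (c + dl) (e - dl) dl (Y s / s0))%:E))).
    by apply: le_trans lo; rewrite lee_fin; lra.
  apply: le_outer_expectation => s; rewrite lee_fin.
  rewrite (le_trans (trapezoid_le_indic _ _ _ dl0))// addrK subrK !indicE.
  rewrite ler_nat; have [|_ //] := boolP (_ \in _); rewrite inE/= in_itv/= => ys.
  by rewrite mem_set.
apply: (@le_trans _ _ (outer_expectation (P n)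
      (fun s => (trapezoid c e dl (Y s / s0))%:E))); last first.
  by apply: le_trans up _; rewrite lee_fin; lra.
apply: le_outer_expectation => s; rewrite lee_fin.
by rewrite (le_trans _ (indic_le_trapezoid _ _ _ dl0))// !indicE.
Qed.

(** Perturbing [Y] by [o(1)] and the scale by [o(1)] moves the event between
    two intervals that approach [[c, e]], whose normal probabilities are
    close since the normal distribution function is Lipschitz. *)
Lemma studentized_outer_prob_cvg (Z : forall n, S n -> R)
    (sg : forall n, S n -> \bar R) (A : forall n, set (S n)) c e :
  (forall eps : R, (0 < eps)%R ->
     outer_negligible P (fun n => [set s | (eps <= `|Z n s - Y s|)%R])) ->
  cvg_outer_prob P sg s0 ->
  (\forall n \near \oo, forall s r, sg n s = r%:E ->
     A n s <-> (c * r <= Z n s <= e * r)%R) ->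
  outer_prob (P n) (A n) @[n --> \oo] --> N `[c, e]%classic.
Proof.
move=> ZY sgs An; set p := fine (N `[c, e]%classic).
have pE a b : N `[a, b]%classic = (fine (N `[a, b]%classic))%:E.
  by rewrite fineK// fin_num_measure.
rewrite pE -/p; apply/cvge_finP => eps eps0.
have pk0 : (0 < pk)%R by rewrite normal_peak_gt0// oner_neq0.
pose dl : R := (eps / (6 * pk))%R.
have dl0 : (0 < dl)%R by rewrite divr_gt0// mulr_gt0.
have dlE : (2 * pk * dl = eps / 3)%R by rewrite /dl; field; rewrite gt_eqF.
have e30 : (0 < eps / 3)%R by rewrite divr_gt0.
pose M : R := (`|c| + `|e| + 1)%R.
have M0 : (0 < M)%R by rewrite ltr_wpDl.
pose e1 : R := (dl * s0 / 2)%R; pose e2 : R := (dl * s0 / (2 * M))%R.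
have ds0 : (0 < dl * s0)%R by exact: mulr_gt0.
have e10 : (0 < e1)%R by exact: divr_gt0.
have e20 : (0 < e2)%R by apply: divr_gt0 => //; exact: mulr_gt0.
pose bad n := [set s | (e1 <= `|Z n s - Y s|)%R] `|`
  [set s | e2%:E <= `|sg n s - s0%:E|].
have /outer_negligibleP/(_ _ e30) badlt : outer_negligible P bad.
  by apply: outer_negligibleU; [exact: ZY|exact: sgs].
have good n s : ~ bad n s -> exists2 r, sg n s = r%:E &
    (forall x : R, `|x| <= M -> `|x * r - x * s0| <= dl * s0 / 2)%R /\
    (`|Z n s - Y s| < dl * s0 / 2)%R.
  move=> /not_orP[/= /negP]; rewrite -ltNge => ZYs /negP; rewrite -ltNge.
  case: (sg n s) => [r| |]; last 2 first.
    by rewrite /= ltNge leey.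
    by rewrite /= ltNge leey.
  rewrite -EFinB /= lte_fin => rs; exists r => //; split => // x xM.
  rewrite -mulrBr normrM (le_trans (ler_pM _ _ xM (ltW rs)))//.
  by rewrite /e2 le_eqVlt; apply/orP; left; apply/eqP; field; rewrite gt_eqF.
have cM : (`|c| <= M)%R by rewrite /M -addrA lerDl addr_ge0.
have eM : (`|e| <= M)%R by rewrite /M addrAC lerDr addr_ge0.
have := @itv_outer_prob_cvg (c - dl)%R (e + dl)%R; rewrite pE => /cvge_finP/(_ _ e30) up.
have := @itv_outer_prob_cvg (c + dl)%R (e - dl)%R; rewrite pE => /cvge_finP/(_ _ e30) lo.
have upI : (fine (N `[(c - dl)%R, (e + dl)%R]%classic) <= p + eps / 3)%R.
  by rewrite -lee_fin -pE EFinD -pE -dlE; exact: std_normal_itv_widen.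
have loI : (p - eps / 3 <= fine (N `[(c + dl)%R, (e - dl)%R]%classic))%R.
  rewrite lerBlDr -lee_fin EFinD -!pE -dlE.
  by have := @std_normal_itv_widen (c + dl)%R (e - dl)%R dl dl0; rewrite addrK subrK.
apply: filterS2 (filterI up lo) (filterI badlt An)
  => n [/andP[_ {}up] /andP[{}lo _]] [{}badlt {}An]; apply/andP; split.
  have : outer_prob (P n) [set s | (c + dl <= Y s / s0 <= e - dl)%R] <=
      outer_prob (P n) (A n) + (eps / 3)%:E.
    apply: (@le_trans _ _ (outer_prob (P n) (A n `|` bad n))); last first.
      by apply: le_trans (outer_probU _ _ _) _; exact: leeD.
    apply: le_outer_prob => s /=; rewrite ler_pdivlMr// ler_pdivrMr// => /andP[cY Ye].
    have [|/good[r sr [xr zy]]] := pselect (bad n s); [by right|left].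
    apply/(An _ _ sr); have := xr _ cM; have := xr _ eM; move: zy.
    rewrite ltr_norml !ler_norml => /andP[? ?] /andP[? ?] /andP[? ?].
    by apply/andP; split; lra.
  rewrite -leeBlDr//; apply: le_trans; apply: le_trans (leeB lo (lexx _)).
  by rewrite -EFinB lee_fin; lra.
apply: (@le_trans _ _ (outer_prob (P n)
    ([set s | (c - dl <= Y s / s0 <= e + dl)%R] `|` bad n))).
  apply: le_outer_prob => s As.
  have [|/good[r sr [xr zy]]] := pselect (bad n s); [by right|left].
  rewrite /= ler_pdivlMr// ler_pdivrMr//.
  move/(An _ _ sr) : As => /andP[? ?]; have := xr _ cM; have := xr _ eM; move: zy.
  rewrite ltr_norml !ler_norml => /andP[? ?] /andP[? ?] /andP[? ?].
  by apply/andP; split; lra.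
apply: le_trans (outer_probU _ _ _) _.
apply: le_trans (leeD up badlt) _.
by rewrite -EFinD lee_fin; lra.
Qed.

End coverage.

(** * Bootstrap Wald interval *)

Theorem theorem3p14 (R : realType)
  (* the sample space, a subset of R^dim through the injection incl *)
  (dim : nat) (dX : measure_display) (X : measurableType dX)
  (incl : X -> 'rV[R]_dim) (inclI : injective incl)
  (* model, target parameter, nuisance parameter and T *)
  (P0 : probability X R)
  (M : set (probability X R)) (P0M : P0 \in M)
  (psi : M -> R) (H : Type) (eta : M -> H)
  (* a total extension of T; its values outside the domain of the partial T
     are never constrained *)
  (T : H -> probability X R -> R)
  (psi0E : psi (exist _ P0 P0M) = T (eta (exist _ P0 P0M)) P0)
  (* influence function *)
  (phi0 : X -> R) (mphi0 : measurable_fun setT phi0)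
  (phi0_sq : P0.-integrable setT (fun x => (phi0 x ^+ 2)%:E))
  (phi0_mean : \int[P0]_x phi0 x = 0)
  (* estimators based on the data *)
  (eta_ : forall n, n.-tuple X -> H)
  (phi_ : forall n, n.-tuple X -> X -> R)
  (* bootstrap sampling *)
  (dW : nat -> measure_display) (W : forall n, measurableType (dW n))
  (Q : forall n, probability (W n) R)
  (gamma : forall n, {mfun (n.-tuple X * W n)%type >-> X})
  (* estimators based on the data and on the bootstrap sample *)
  (etaB : forall n, n.-tuple X -> n.-tuple X -> H)
  (phiB : forall n, n.-tuple X -> n.-tuple X -> X -> R)
  (alpha beta : R)
  (alpha01 : 0 < alpha < 1) (beta01 : 0 < beta < 1) (ab1 : alpha + beta < 1) :
  let psi0 := psi (exist _ P0 P0M) in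
  let eta0 := eta (exist _ P0 P0M) in
  let sigma0 := Num.sqrt (\int[P0]_x (phi0 x ^+ 2)) in
  let rootn_inv := fun n : nat => (Num.sqrt (n%:R : R))^-1 in
  let Pn := fun n (x : n.-tuple X) => empirical x : probability X R in
  let Phat := fun n (x : n.-tuple X) => boot_law Q gamma x in
  let PnB := fun n (x : n.-tuple X) (w : n.-tuple (W n)) =>
    boot_empirical R gamma x w in
  let etanB := fun n (x : n.-tuple X) (w : n.-tuple (W n)) =>
    etaB n x (boot_sample gamma x w) in
  let phinB := fun n (x : n.-tuple X) (w : n.-tuple (W n)) =>
    phiB n x (boot_sample gamma x w) in
  let Rn := fun n (x : n.-tuple X) =>
    remainder T (eta_ n x) (Pn n x) eta0 P0 (phi_ n x) in
  let RnB := fun n (x : n.-tuple X) (w : n.-tuple (W n)) =>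
    remainder T (etanB n x w) (PnB n x w) (eta_ n x) (Phat n x)
      (phinB n x w) in
  let TnB := fun n (x : n.-tuple X) (w : n.-tuple (W n)) =>
    Num.sqrt n%:R * (T (etanB n x w) (PnB n x w) - T (eta_ n x) (Phat n x)) in
  (* sigma_bar_n^2 = E_W^* [T_n^*^2], possibly infinite *)
  let sigma_bar := fun n (x : n.-tuple X) =>
    ((EW Q (fun w => (TnB n x w ^+ 2)%:E)) `^ 2^-1)%E in
  let lower := fun n (x : n.-tuple X) =>
    ((T (eta_ n x) (Pn n x))%:E +
     (normal_quantile beta)%:E * sigma_bar n x * (rootn_inv n)%:E)%E in
  let upper := fun n (x : n.-tuple X) =>
    ((T (eta_ n x) (Pn n x))%:E +
     (normal_quantile (1 - alpha))%:E * sigma_bar n x * (rootn_inv n)%:E)%E in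
  (* (A1); phi_n lies in F with (inner) probability tending to 1 *)
  (exists F : set (X -> R),
    [/\ forall f, F f -> measurable_fun setT f,
        F phi0,
        (fun n => outer_prob (iid_law P0 n) [set x | ~ F (phi_ n x)])
          @ \oo --> 0%E &
        exists2 L : probability (borel_linf R F) R, brownian_bridge P0 L &
          weak_cvg (iid_law P0) (fun n x => scaled_process n (Pn n x) P0 (F := F)) L]) ->
  (* (A2) *)
  little_oP (iid_law P0)
    (fun n x => 'N[P0]_2%:E[EFin \o (phi_ n x \- phi0)%R])%E
    (fun=> 1) ->
  (* (A3) *)
  little_oP (iid_law P0) (fun n x => (Rn n x)%:E) rootn_inv ->
  (* (B1); conditionally on the data, phi_n^* lies in F with (inner)
     probability tending to 1 *)
  (exists F : set (X -> R),
    [/\ forall f, F f -> measurable_fun setT f,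
        F phi0,
        cvg_outer_prob (iid_law P0)
          (fun n x => PW Q [set w | ~ F (phinB n x w)]) 0 &
        exists2 L : probability (borel_linf R F) R, brownian_bridge P0 L &
          cond_weak_cvg P0 Q
            (fun n x w => scaled_process n (PnB n x w) (Phat n x) (F := F)) L]) ->
  (* (B2) *)
  little_oPW P0 Q
    (fun n x w => 'N[P0]_2%:E[EFin \o (phinB n x w \- phi0)%R])%E
    (fun=> 1) ->
  (* (B3) *)
  little_oPW P0 Q (fun n x w => (RnB n x w)%:E) rootn_inv ->
  (* asymptotic uniform square-integrability *)
  (fun m : nat => limn_esup (fun n => outer_expectation (iid_law P0 n)
    (fun x => EW Q (fun w =>
      (TnB n x w ^+ 2 * \1_[set t : R | m%:R <= t] (TnB n x w ^+ 2))%:E))))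
    @ \oo --> 0%E ->
  cvg_outer_prob (iid_law P0) sigma_bar sigma0 /\
  (0 < sigma0 ->
    (fun n => outer_prob (iid_law P0 n)
      [set x | (lower n x <= psi0%:E <= upper n x)%E])
      @ \oo --> (1 - alpha - beta)%:E).
Proof.
move=> psi0 eta0 sigma0 rootn_inv Pn Phat PnB etanB phinB Rn RnB TnB sigma_bar lower upper.
move=> [F [mF Fphi0 FA [L PL Lcvg]]] A2 A3 [G [mG Gphi0 GB [LB PLB LBcvg]]] B2 B3 UI.
have rootnK n : (rootn_inv n)^-1 = Num.sqrt n%:R by rewrite /rootn_inv invrK.
have covE : covariance_under P0 phi0 phi0 = \int[P0]_x (phi0 x ^+ 2).
  rewrite /covariance_under phi0_mean mul0r subr0.
  by congr Rintegral; apply/funext => x; rewrite expr2.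
have split_le (e a b c : R) : e <= `|a| -> a = b + c -> e / 2 <= `|b| \/ e / 2 <= `|c|.
  move=> ea abc; have := ler_normD b c; rewrite -abc.
  by have [|b2] := leP (e / 2) `|b|; [left|move=> ?; right; lra].
pose g0 : G := SigSub (mem_set Gphi0).
(* indexed by all functions, so that a [phinB n x w] outside of the class [G]
   may be inserted *)
pose DB n (x : n.-tuple X) (w : n.-tuple (W n)) (f : X -> R) :=
  Num.sqrt n%:R * diff_integral (PnB n x w) (Phat n x) f.
have DBcvg : cond_weak_cvg P0 Q (fun n x w (f : G) => DB n x w (set_val f)) LB by exact: LBcvg.
have sb : cvg_outer_prob (iid_law P0) sigma_bar sigma0.
  apply: sqrt_cvg_outer_prob; first exact: sqrtr_ge0.
    by move=> n x; apply: outer_expectation_ge0 => w; rewrite lee_fin sqr_ge0.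
  apply: (@cond_second_moment_cvg _ _ _ P0 _ W Q TnB (fun n x w => DB n x w phi0)) => //.
    move=> e e0; have e20 : 0 < e / 2 by rewrite divr_gt0.
    have C1 := cvg_outer_prob_negligible (B3 _ e20).
    have C2 := @cond_weak_cvg_increment _ _ X P0 _ W Q G mG LB PLB DB DBcvg
      phinB g0 (e / 2) e20 (cvg_outer_prob_negligible GB).
    have {}C2 := C2 (fun c c0 => cond_negligibleS _ (cvg_outer_prob_negligible (B2 c c0))).
    have {}C2 := C2 _.
    apply: cond_negligibleS (cond_negligibleU C1 (C2 _)).
      move=> n x w /= eTV.
      have TE : TnB n x w - DB n x w phi0 = Num.sqrt n%:R * RnB n x w +
          (DB n x w (phinB n x w) - DB n x w phi0).
        by rewrite /TnB /RnB /remainder /DB; ring.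
      case: (split_le _ _ _ _ eTV TE) => [h|h]; [left|right => //].
      rewrite rootnK -EFinM lee_fin (le_trans h)// normrM (ger0_norm (sqrtr_ge0 _)).
      by rewrite mulrC.
    by move=> c n x w /=; rewrite invr1 mule1 gee0_abs ?Lnorm_ge0.
  move=> m e m0 e0; have := cond_trunc_moment_cvg PLB DBcvg g0 m0 e0.
  by rewrite /= covE.
split => // sigma0_gt0.
pose f0 : F := SigSub (mem_set Fphi0).
pose D n (x : n.-tuple X) (f : X -> R) :=
  Num.sqrt n%:R * diff_integral (Pn n x) P0 f.
have Dcvg : weak_cvg (iid_law P0) (fun n x (f : F) => D n x (set_val f)) L by exact: Lcvg.
(* [psi0] lies in the interval when [Z], defined below, lies between the
   multiples [- z_(1 - alpha)] and [- z_beta] of [sigma_bar] *)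
rewrite -(normal_quantile_itv alpha01 beta01 ab1).
pose Z n (x : n.-tuple X) := Num.sqrt n%:R * (T (eta_ n x) (Pn n x) - psi0).
apply: (@studentized_outer_prob_cvg R _ _ (iid_law P0) (fun n x => D n x phi0) sigma0
  sigma0_gt0 _ Z sigma_bar).
- move=> g cg g01; have := @weak_cvg_marginal R _ X P0 F L PL _ _ (iid_law P0) D f0 g Dcvg cg g01.
  by rewrite /= covE.
- move=> e e0; have e20 : 0 < e / 2 by rewrite divr_gt0.
  have C1 := A3 _ e20.
  have C2 := weak_cvg_increment mF PL e20 Dcvg FA (phi := phi_) (f0 := f0).
  apply: outer_negligibleS (outer_negligibleU C1 (C2 _)).
    apply: nearW => n x /= eZY.
    have ZE : Z n x - D n x phi0 = Num.sqrt n%:R * Rn n x +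
          (D n x (phi_ n x) - D n x phi0).
      by rewrite /Z /Rn /remainder /D /psi0 psi0E /eta0; ring.
    case: (split_le _ _ _ _ eZY ZE) => [h|h]; [left|right => //].
    by rewrite /= rootnK subr0 lee_fin (mulrC (Rn n x)).
  move=> c c0; apply: outer_negligibleS (A2 _ c0); apply: nearW => n x /=.
  by rewrite invr1 mule1 sube0 gee0_abs ?Lnorm_ge0.
- exact: sb.
- near=> n => x r sr.
  have n0 : 0 < Num.sqrt (n%:R : R) by rewrite sqrtr_gt0 ltr0n; near: n; exact: nbhs_infty_gt.
  rewrite /= /lower /upper sr -!EFinM -!EFinD !lee_fin /Z /rootn_inv.
  set sn := Num.sqrt n%:R in n0 *; set u := T _ _.
  have snE (q : R) : q * r / sn * sn = q * r by rewrite divfK// gt_eqF.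
  have lowE q : (u + q * r / sn <= psi0) = (sn * (u - psi0) <= - q * r).
    by rewrite -[LHS](ler_pM2r n0) mulrDl snE mulNr; apply/idP/idP => ?; lra.
  have upE q : (psi0 <= u + q * r / sn) = (- q * r <= sn * (u - psi0)).
    by rewrite -[LHS](ler_pM2r n0) mulrDl snE mulNr; apply/idP/idP => ?; lra.
  by rewrite lowE upE andbC.
Unshelve. all: by end_near. Qed.
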